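(* Let $q\geq 2$ and $3\leq t_1\leq\cdots\leq t_q$ be integers, and let $G=K_1*\left(\bigsqcup_{i=1}^q P_{t_i}\right)$. Then $G$ is a connected weakly closed graph with $\ell(G)=t_q-1$ and $$\operatorname{reg}(J_G)=\sum_{i=1}^q t_i-q+1,$$ and in particular $\operatorname{reg}(J_G)\neq \ell(G)+1$. Moreover, if for each $q\geq 2$ one sets $G_q=K_1*\left(\bigsqcup_{i=1}^q P_{t_i}\right)$ with $t_1=\cdots=t_q=q^2$, then $$\lim_{q\to\infty}\frac{\operatorname{reg}(J_{G_q})}{\ell(G_q)+1}=\infty.$$
   Context: Let $\mathbb{K}$ be a field. For a finite simple graph $G$ on a finite totally ordered vertex set $V$ with edge set $E$, the binomial edge ideal of $G$ is the ideal $J_G=(x_iy_j-x_jy_i : i<j,\ \{i,j\}\in E)$ of $\mathbb{K}[x_i,y_i : i\in V]$, and $\operatorname{reg}$ denotes Castelnuovo–Mumford regularity of a graded ideal (standard grading). $K_1$ is the one-vertex graph, $P_t$ is the path graph with $t$ vertices, and $\bigsqcup$ denotes disjoint union of graphs. The join $G_1*G_2$ of two graphs with disjoint vertex sets $V_1,V_2$ and edge sets $E_1,E_2$ is the graph with vertex set $V_1\cup V_2$ and edge set $E_1\cup E_2\cup\{\{v,w\} : v\in V_1,\ w\in V_2\}$. $\ell(G)$ denotes the length (number of edges) of a longest induced path of $G$. A graph with $n$ vertices is weakly closed if its vertices can be labeled by $[n]=\{1,\ldots,n\}$ so that for all $i,j\in[n]$ with $j>i+1$ and $\{i,j\}\in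 E$, and for all $i<k<j$, one has $\{i,k\}\in E$ or $\{j,k\}\in E$. *)

(* Defs.v *)
From mathcomp Require Import all_boot all_order all_algebra.

Set Implicit Arguments.
Unset Strict Implicit.
Unset Printing Implicit Defensive.

Import GRing.Theory.

Record sgraph := SGraph {
  vertex :> finType;
  edge : rel vertex;
  edge_sym : symmetric edge;
  edge_irr : irreflexive edge }.

Lemma complete_graph_sym n : symmetric (fun i j : 'I_n => i != j).
Proof. by move=> i j; rewrite eq_sym. Qed.

Lemma complete_graph_irr n : irreflexive (fun i j : 'I_n => i != j).
Proof. by move=> i; rewrite eqxx. Qed.

Definition complete_graph (n : nat) : sgraph :=
  SGraph (@complete_graph_sym n) (@complete_graph_irr n).

Lemma path_graph_sym n :
  symmetric (fun i j : 'I_n => (i.+1 == j :> nat) || (j.+1 == i :> nat)).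
Proof. by move=> i j; rewrite orbC. Qed.

Lemma path_graph_irr n :
  irreflexive (fun i j : 'I_n => (i.+1 == j :> nat) || (j.+1 == i :> nat)).
Proof. by move=> i; rewrite orbb; apply/negbTE; rewrite neq_ltn ltnSn orbT. Qed.

Definition path_graph (n : nat) : sgraph :=
  SGraph (@path_graph_sym n) (@path_graph_irr n).

Section DisjointUnion.
Variables (I : finType) (G : I -> sgraph).

Definition disjoint_union_edge : rel {i : I & G i} :=
  fun u v => (tag u == tag v) && edge (tagged u) (tagged_as u v).

Lemma disjoint_union_sym : symmetric disjoint_union_edge.
Proof.
move=> [i u] [j v]; rewrite /disjoint_union_edge /= eq_sym.
by case: eqP => //= eq_ji; case: _ / eq_ji u => u; rewrite !tagged_asE edge_sym.
Qed.

Lemma disjoint_union_irr : irreflexive disjoint_union_edge.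
Proof. by move=> [i u]; rewrite /disjoint_union_edge tagged_asE edge_irr andbF. Qed.

Definition disjoint_union : sgraph :=
  SGraph disjoint_union_sym disjoint_union_irr.

End DisjointUnion.

Section Join.
Variables G1 G2 : sgraph.

Definition join_edge : rel (G1 + G2)%type := fun u v =>
  match u, v with
  | inl u1, inl v1 => edge u1 v1
  | inr u2, inr v2 => edge u2 v2
  | _, _ => true
  end.

Lemma join_sym : symmetric join_edge.
Proof. by move=> [u|u] [v|v] //=; exact: edge_sym. Qed.

Lemma join_irr : irreflexive join_edge.
Proof. by move=> [u|u] /=; exact: edge_irr. Qed.

Definition join : sgraph := SGraph join_sym join_irr.

End Join.

Definition connected_graph (G : sgraph) : Prop :=
  (0 < #|G|)%N /\ forall u v : G, connect (@edge G) u v.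

(** [label] enumerates the vertices; labels run over 0, ..., n-1 instead of
    1, ..., n. *)
Definition weakly_closed (G : sgraph) : Prop :=
  exists2 label : 'I_#|G| -> G, bijective label &
    forall i j : 'I_#|G|, (i.+1 < j)%N -> edge (label i) (label j) ->
    forall k : 'I_#|G|, (i < k < j)%N ->
      edge (label i) (label k) \/ edge (label j) (label k).

Definition induced_copy (H G : sgraph) : bool :=
  [exists f : {ffun H -> G},
    injectiveb f && [forall u, forall v, edge (f u) (f v) == edge u v]].

(** The path with k edges has k+1 vertices, so an induced one forces k < #|G|. *)
Definition longest_induced_path (G : sgraph) : nat :=
  \max_(k < #|G| | induced_copy (path_graph k.+1) G) k.

(* Imported only here because mpoly shadows [symmetric]. *)
From mathcomp Require Import mpoly classical_sets.

Local Open Scope ring_scope.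
Local Open Scope classical_set_scope.

Section Regularity.
Variables (K : fieldType) (n : nat).
Local Notation S := {mpoly K[n]}.

Definition generated_ideal (B : S -> Prop) (p : S) : Prop :=
  exists (k : nat) (c g : 'I_k -> S),
    (forall i, B (g i)) /\ p = \sum_(i < k) c i * g i.

(** [... -> F_1 -> F_0 -> I -> 0] with F_i = (+)_a S(- res_shift i a), where
    elements of F_i are row vectors and maps act by right multiplication.
    Homogeneity of degree 0 of the maps is expressed on the matrix entries. *)
Record graded_free_resolution (I : S -> Prop) := GradedFreeResolution {
  res_rank : nat -> nat;
  res_shift : forall i, 'I_(res_rank i) -> nat;
  res_aug : 'cV[S]_(res_rank 0);
  res_diff : forall i, 'M[S]_(res_rank i.+1, res_rank i);
  res_aug_homog : forall a, res_aug a 0 \is (res_shift a).-homog;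
  res_diff_homog : forall i a b, res_diff i a b = 0 \/
    exists2 e, res_shift a = (res_shift b + e)%N & res_diff i a b \is e.-homog;
  res_aug_image : forall p, I p <->
    exists v : 'rV[S]_(res_rank 0), p = (v *m res_aug) 0 0;
  res_exact0 : forall v : 'rV[S]_(res_rank 0),
    v *m res_aug = 0 <-> exists w : 'rV[S]_(res_rank 1), v = w *m res_diff 0;
  res_exactS : forall i (v : 'rV[S]_(res_rank i.+1)),
    v *m res_diff i = 0 <-> exists w : 'rV[S]_(res_rank i.+2), v = w *m res_diff i.+1 }.

(** The differentials map F_{i+1} into (X_1, ..., X_n) F_i. *)
Definition minimal_resolution (I : S -> Prop) (F : graded_free_resolution I) :
  Prop := forall i a b, (res_diff F i a b)@_(0%MM) = 0.

(** [m] is the maximum of [j - i] over the [i], [j] such that S(-j) is a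
    summand of the i-th module of a minimal graded free resolution of [I]. *)
Definition has_regularity (I : S -> Prop) (m : int) : Prop :=
  exists F : graded_free_resolution I,
    [/\ minimal_resolution F,
        forall i (a : 'I_(res_rank F i)), (res_shift a)%:Z - i%:Z <= m &
        exists i, exists a : 'I_(res_rank F i), (res_shift a)%:Z - i%:Z = m].

(** The junk value 0 is taken only when no minimal resolution with bounded
    [j - i] exists or all its terms vanish. *)
Definition reg (I : S -> Prop) : int := xget 0 [set m | has_regularity I m].

End Regularity.

Definition total_order (T : Type) (le : rel T) : Prop :=
  [/\ reflexive le, antisymmetric le, transitive le & total le].

Section BinomialEdgeIdeal.
Variables (K : fieldType) (G : sgraph).

(** K[x_i, y_i : i in V(G)]: the x's are the first #|G| variables, the y's the
    last #|G| ones. *)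
Definition edge_ring := {mpoly K[#|G| + #|G|]}.

Definition xvar (i : G) : edge_ring := 'X_(lshift #|G| (enum_rank i)).
Definition yvar (i : G) : edge_ring := 'X_(rshift #|G| (enum_rank i)).

Definition binomial_edge_ideal (le : rel G) : edge_ring -> Prop :=
  generated_ideal (fun p => exists i j : G,
    [/\ i != j, le i j, edge i j & p = xvar i * yvar j - xvar j * yvar i]).

End BinomialEdgeIdeal.

Arguments binomial_edge_ideal K [G] le _.

(** The t_1, ..., t_q of the mathematics are t 0, ..., t (q-1). *)
Definition cone_over_paths (q : nat) (t : nat -> nat) : sgraph :=
  join (complete_graph 1) (disjoint_union (fun i : 'I_q => path_graph (t i))).

(* Main.v *)
(** Castelnuovo-Mumford regularity is read off Koszul homology: in a minimal
    graded free resolution of an ideal [I], the shift [i + e] occurs at level [i]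
    iff [H_i(X; I)_(i + e) <> 0] (dimension shifting), and a minimal resolution
    exists as soon as this homology vanishes for large [e].

    Let [H] be the disjoint union of the paths, [W] its vertex set, [v] the apex,
    and [J_A] the ideal of the complete graph on a vertex set [A].  Then [J_G] is
    the intersection of [J_(v, W)] and [(x_v, y_v) + J_H], whose sum is
    [(x_v, y_v) + J_W].  The quotients by [J_(v, W)] and [J_W] have regularity at
    most 1, by induction on the number of vertices, while [J_H] is generated by a
    regular sequence of [r] quadrics, where [r] is the number of edges of [H], so
    that its quotient has regularity [r].  As [r > 2], the Mayer-Vietoris
    sequence gives [reg S/J_G = r].  An induced path through [v] has at most three
    vertices, and any other one stays in a component of [H]. *)
From HB Require Import structures.
Require Import Defs.
From mathcomp Require Import all_boot all_order all_algebra ring zify.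

Set Implicit Arguments.
Unset Strict Implicit.
Unset Printing Implicit Defensive.

(** So vanishing for S/J is stated by coefficient degree alone, where each long exact sequence
    becomes a short element chase, and homological degrees are separated only in passing from S/J to
    J and its syzygies. The connecting map sends H_(i+1)(S/J)_(i+1+e) to H_i(J)_(i+e+1), an
    isomorphism for e > 0; hence the regularity of the ideal exceeds that of its quotient by one.

    Long exact sequences alone bound regularity from above. For the lower bound, multiplication by a
    variable or an edge binomial is null-homotopic on Koszul chains, so dividing by a nonzerodivisor
    of this kind cannot destroy the extremal class; Mayer-Vietoris then transports it to J_G once
    the sum ideal vanishes in that degree.

    Resolutions are built without noetherianity: vanishing of H_0 in large degrees bounds the
    degrees of generators, and each graded piece is finite-dimensional. Likewise primality of
    determinantal ideals is replaced by nonzerodivisor statements proved by setting variables to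
    0. *)

Module ConeRegularity.
From mathcomp Require Import mpoly classical_sets boolp.
Import Order.TTheory GRing.Theory Num.Theory.
Local Open Scope ring_scope.

(** * Koszul homology *)

Section Submodules.
Variables (S : comNzRingType) (M : lmodType S).
Implicit Types A B : M -> Prop.

Record subgroup A : Prop := Subgroup {
  subgroup0 : A 0;
  subgroupB : forall a b, A a -> A b -> A (a - b) }.

Record submodule A : Prop := Submodule {
  submodule_subgroup :> subgroup A;
  submoduleZ : forall (s : S) a, A a -> A (s *: a) }.

Lemma subgroupN A a : subgroup A -> A a -> A (- a).
Proof. by move=> [A0 AB] Aa; rewrite -sub0r; apply: AB. Qed.

Lemma subgroupD A a b : subgroup A -> A a -> A b -> A (a + b).
Proof.
by move=> sA Aa Ab; rewrite -[b]opprK; apply: subgroupB => //; apply: subgroupN.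
Qed.

Definition sum_pred A B m := exists a b, [/\ A a, B b & m = a + b].

Definition add_multiples A (f : S) m := exists a b, A a /\ m = a + f *: b.

Lemma sum_pred_submodule A B :
  submodule A -> submodule B -> submodule (sum_pred A B).
Proof.
move=> sA sB; split; first split.
- by exists 0, 0; rewrite addr0; split=> //; [exact: (subgroup0 sA) | exact: (subgroup0 sB)].
- move=> _ _ [a [b [Aa Bb ->]]] [a' [b' [Aa' Bb' ->]]].
  exists (a - a'), (b - b'); split; first exact: (subgroupB sA).
    exact: (subgroupB sB).
  by rewrite opprD addrACA.
- move=> s _ [a [b [Aa Bb ->]]]; exists (s *: a), (s *: b); split.
  + exact: submoduleZ.
  + exact: submoduleZ.
  + exact: scalerDr.
Qed.

Definition intersection A B m := A m /\ B m.

Definition nonzerodivisor_mod A (f : S) := forall m, A (f *: m) -> A m.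

End Submodules.

(** Chains of the Koszul complex of [xs] with coefficients in [M]: a pair
    [(c0, c1)] stands for [c0 + e_x c1], where [x] is the head of [xs]. *)
Section KoszulComplex.
Variables (S : comNzRingType) (M : lmodType S).
Implicit Types (xs : seq S) (A B : M -> Prop).

Fixpoint kos xs : lmodType S :=
  if xs is _ :: xs' then (kos xs' * kos xs')%type : lmodType S else M.

(** The Koszul rule d(e_x c) = x c - e_x (d c), applied to c0 + e_x c1. *)
Fixpoint kd xs : kos xs -> kos xs :=
  match xs return kos xs -> kos xs with
  | [::] => fun=> 0
  | x :: xs' => fun c => (kd c.1 + x *: c.2, - kd c.2)
  end.

Lemma kd_is_linear xs : linear (@kd xs).
Proof.
elim: xs => [|x xs IH] a u v /=; first by rewrite scaler0 addr0.
apply: injective_projections => /=; last by rewrite IH opprD scalerN.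
by rewrite !IH !scalerDr !scalerA [x * a]mulrC addrACA.
Qed.

HB.instance Definition _ xs :=
  GRing.isLinear.Build S (kos xs) (kos xs) _ (@kd xs) (@kd_is_linear xs).

Lemma kd_kd xs (c : kos xs) : kd (kd c) = 0.
Proof.
elim: xs c => [|x xs IH] c //=.
by apply: injective_projections;
  rewrite /= ?(linearD, linearN, linearZ) /= !IH ?oppr0 // add0r scalerN addrN.
Qed.

(** Homology with coefficients in M/A is computed with chains of M modulo [kin A], and homology of A
    itself with chains inside [kin A]; no quotient or submodule type has to be formed. *)
Fixpoint kin A xs : kos xs -> Prop :=
  match xs return kos xs -> Prop with
  | [::] => A
  | x :: xs' => fun c => kin A c.1 /\ kin A c.2
  end.

Lemma kin_mono A B xs (c : kos xs) :
  (forall m, A m -> B m) -> kin A c -> kin B c.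
Proof.
by move=> sAB; elim: xs c => [|x xs IH] c /=; [exact: sAB | case=> /IH ? /IH ?].
Qed.

Lemma kin_subgroup A xs : subgroup A -> subgroup (@kin A xs).
Proof.
move=> sA; elim: xs => [|x xs [IH0 IHB]] //; split=> [|c d [? ?] [? ?]] /=.
  by split; exact: IH0.
by split; exact: IHB.
Qed.

Lemma kin_submodule A xs : submodule A -> submodule (@kin A xs).
Proof.
move=> sA; split; first exact: (kin_subgroup _ sA).
by elim: xs => [|x xs IH] s c /=; [exact: submoduleZ | case; split; exact: IH].
Qed.

Lemma kin_kd A xs (c : kos xs) : submodule A -> kin A c -> kin A (kd c).
Proof.
move=> sA; elim: xs c => [|x xs IH] c /=; first by move=> _; exact: (subgroup0 sA).
move=> [c1 c2]; have sK := kin_submodule xs sA; split.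
  by apply: (subgroupD sK); [exact: IH | exact: submoduleZ].
by apply: (subgroupN sK); exact: IH.
Qed.

Lemma kin_intersection A B xs (c : kos xs) :
  kin A c -> kin B c -> kin (intersection A B) c.
Proof.
by elim: xs c => [|x xs IH] c /=; [split | move=> [? ?] [? ?]; split; exact: IH].
Qed.

Lemma kin_sum A B xs (c : kos xs) : kin (sum_pred A B) c ->
  exists a b, [/\ kin A a, kin B b & c = a + b].
Proof.
elim: xs c => [|x xs IH]; first by [].
case=> c1 c2 /=.
move=> [] /= /IH [a1 [b1 [? ? ->]]] /IH [a2 [b2 [? ? ->]]].
by exists (a1, a2), (b1, b2).
Qed.

Lemma kin_add_multiples A f xs (c : kos xs) : kin (add_multiples A f) c ->
  exists a b, kin A a /\ c = a + f *: b.
Proof.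
elim: xs c => [|x xs IH]; first by [].
case=> c1 c2 /=.
move=> [] /= /IH [a1 [b1 [? ->]]] /IH [a2 [b2 [? ->]]].
by exists (a1, a2), (b1, b2).
Qed.

Lemma kin_nonzerodivisor A f xs (c : kos xs) :
  nonzerodivisor_mod A f -> kin A (f *: c) -> kin A c.
Proof.
move=> nzd; elim: xs c => [|x xs IH] c /=; first exact: nzd.
by case; split; exact: IH.
Qed.

(** The homotopy is exterior multiplication by the generator of [x], with a sign for each generator
    it passes. It only moves coefficients around up to sign, so it respects every subgroup of
    coefficients. *)
Lemma koszul_homotopy xs x : x \in xs -> exists h : kos xs -> kos xs,
  [/\ linear h, forall c, kd (h c) = x *: c - h (kd c) &
      forall A c, subgroup A -> kin A c -> kin A (h c)].
Proof.
elim: xs => [|x' xs IH] //; rewrite inE; case: eqVneq => [-> _|_ /= /IH].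
  exists (fun c => (0, c.1)); split=> [a u v|c|A c sA [c1 c2]] /=.
  - by apply: injective_projections => //=; rewrite scaler0 addr0.
  - apply: injective_projections => /=; first by rewrite linear0 add0r subr0.
    by rewrite opprD addrC -addrA addNr addr0.
  - by split=> //; exact: (subgroup0 (kin_subgroup _ sA)).
case=> h [hlin hd hin]; pose H : {linear kos xs -> kos xs} :=
  HB.pack h (GRing.isLinear.Build _ _ _ _ h hlin).
have hB u v : h (u + v) = h u + h v by exact: (linearD H).
have hN u : h (- u) = - h u by exact: (linearN H).
have hZ (s : S) u : h (s *: u) = s *: h u by exact: (linearZ_LR H).
exists (fun c => (h c.1, - h c.2)); split=> [a u v|c|A c sA [c1 c2]] /=.
- by apply: injective_projections => /=; rewrite hB hZ // opprD scalerN.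
- apply: injective_projections => /=; first by rewrite hd hB hZ opprD scalerN addrA.
  by rewrite linearN /= hd hN !opprK.
- by split; [|apply: (subgroupN (kin_subgroup _ sA))]; exact: hin.
Qed.

(** The component without any exterior generator. *)
Fixpoint kbot xs : kos xs -> M :=
  match xs return kos xs -> M with
  | [::] => id
  | x :: xs' => fun c => kbot c.1
  end.

Fixpoint kemb xs : M -> kos xs :=
  match xs return M -> kos xs with
  | [::] => id
  | x :: xs' => fun m => (kemb xs' m, 0)
  end.

Lemma kd_kemb xs m : kd (kemb xs m) = 0.
Proof.
elim: xs => [|x xs IH] //=.
by apply: injective_projections => /=; rewrite ?IH ?linear0 ?scaler0 ?add0r ?oppr0.
Qed.

Lemma kbot_kemb xs m : kbot (kemb xs m) = m.
Proof. by elim: xs. Qed.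

Lemma kbotD xs : {morph @kbot xs : c d / c + d}.
Proof. by elim: xs => [|x xs IH] c d //=; rewrite IH. Qed.

Lemma kbotZ xs s : {morph @kbot xs : c / s *: c}.
Proof. by elim: xs => [|x xs IH] c //=; rewrite IH. Qed.

Lemma kbotB xs : {morph @kbot xs : c d / c - d}.
Proof. by move=> c d; rewrite kbotD -scaleN1r kbotZ scaleN1r. Qed.

Lemma kin_kbot A xs (c : kos xs) : kin A c -> A (kbot c).
Proof. by elim: xs c => [|x xs IH] c //= [] /IH. Qed.

Lemma kin_kemb A xs m : subgroup A -> A m -> kin A (kemb xs m).
Proof.
move=> sA Am; elim: xs => [|x xs IH] //=; split=> //.
exact: (subgroup0 (kin_subgroup _ sA)).
Qed.

Fixpoint combination xs A m : Prop :=
  if xs is x :: xs' then exists a b, [/\ A a, combination xs' A b & m = x *: a + b]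
  else m = 0.

Lemma kbot_kd A xs (c : kos xs) : kin A c -> combination xs A (kbot (kd c)).
Proof.
elim: xs c => [|x xs IH] c //= [c1 c2].
exists (kbot c.2), (kbot (kd c.1)); split; first exact: kin_kbot.
  exact: IH.
by rewrite kbotD kbotZ addrC.
Qed.

Lemma combination_mono A B xs m :
  (forall m, A m -> B m) -> combination xs A m -> combination xs B m.
Proof.
move=> sAB; elim: xs m => [|x xs IH] m //= [a [b [/sAB Ba /IH Bb ->]]].
by exists a, b.
Qed.

(** Weak regularity with the list read from its end: each entry is tested modulo the entries after
    it, which matches the recursion of [kos] on the tail. *)
Fixpoint regular_sequence xs : Prop :=
  if xs is x :: xs' then
    nonzerodivisor_mod (combination xs' (fun=> True)) x /\ regular_sequence xs'
  else True.

Lemma kin_true xs (c : kos xs) : kin (fun=> True) c.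
Proof. by elim: xs c => //= x xs IH c; split. Qed.

(** Since chains have mixed homological degree, acyclicity in positive degrees is expressed by
    asking that the degree 0 component be zero in H_0, that is, lie in the submodule generated by
    the multiples of [xs]. *)
Lemma koszul_acyclic xs (c : kos xs) : regular_sequence xs ->
  kd c = 0 -> combination xs (fun=> True) (kbot c) -> exists w, kd w = c.
Proof.
have sT : submodule (fun _ : M => True) by [].
elim: xs c => [|x xs IH] /=; first by move=> *; exists 0.
case=> c0 c1 /=.
move=> [nzd reg] [d0 d1] [a [b [_ cb bot]]].
have {}d1 : kd c1 = 0 by apply: oppr_inj; rewrite d1 oppr0.
have [w1 dw1] : exists w, kd w = c1.
  apply: IH => //; apply: nzd; rewrite -kbotZ.
  have -> : x *: c1 = - kd c0 by apply/eqP; rewrite -addr_eq0 addrC d0.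
  rewrite -[- kd c0]linearN; apply: kbot_kd.
  exact: kin_true.
(* The constant chain removes all multiples of [x] from the bottom component and leaves [b], to
   which the induction hypothesis for the tail applies. *)
have [w0 dw0] : exists w, kd w = c0 + x *: w1 - x *: kemb xs (kbot w1 + a).
  apply: IH => //.
    by rewrite linearB linearD !linearZ /= dw1 d0 kd_kemb oppr0 scaler0 addr0.
  rewrite kbotB kbotD !kbotZ kbot_kemb bot scalerDr [x *: a + b]addrC -[b + _ + _]addrA.
  by rewrite [x *: a + _]addrC addrK.
exists (w0, kemb xs (kbot w1 + a) - w1).
apply: injective_projections => /=; last by rewrite linearB /= kd_kemb dw1 sub0r opprK.
by rewrite dw0 scalerBr addrA subrK addrK.
Qed.

Lemma kin_eq0 xs (c : kos xs) : kin (fun m => m = 0) c <-> c = 0.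
Proof.
elim: xs c => [|x xs IH]; first by [].
by case=> c0 c1 /=; split=> [[/IH -> /IH ->]|[/IH ? /IH ?]].
Qed.

(** Projection onto exterior degree [i]. It commutes with the differential up to a shift, so
    homology splits along it. *)
Fixpoint khom_proj xs i : kos xs -> kos xs :=
  match xs return kos xs -> kos xs with
  | [::] => fun c => if i is 0 then c else 0
  | x :: xs' => fun c =>
      (khom_proj i c.1, if i is i'.+1 then khom_proj i' c.2 else 0)
  end.

Lemma khom_proj_is_linear xs i : linear (@khom_proj xs i).
Proof.
elim: xs i => [|x xs IH] [|i] a u v //=; first by rewrite scaler0 addr0.
  by apply: injective_projections => /=; rewrite ?IH ?scaler0 ?addr0.
by apply: injective_projections => /=; rewrite ?IH.
Qed.

HB.instance Definition _ xs i :=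
  GRing.isLinear.Build S (kos xs) (kos xs) _ (@khom_proj xs i)
    (@khom_proj_is_linear xs i).

Lemma khom_proj0 xs (c : kos xs) : khom_proj 0 c = kemb xs (kbot c).
Proof. by elim: xs c => [|x xs IH] c //=; rewrite IH. Qed.

Lemma kd_khom_proj xs i (c : kos xs) :
  kd (khom_proj i.+1 c) = khom_proj i (kd c).
Proof.
elim: xs i c => [|x xs IH] i c /=; first by case: i.
apply: injective_projections => /=; first by rewrite IH linearD linearZ.
case: i => [|i]; first by rewrite khom_proj0 kd_kemb oppr0.
by rewrite IH linearN.
Qed.

Lemma khom_proj_idem xs i j (c : kos xs) :
  khom_proj i (khom_proj j c) = if i == j then khom_proj i c else 0.
Proof.
elim: xs i j c => [|x xs IH] i j c /=; first by case: i j => [|i] [|j] //=; case: eqP.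
apply: injective_projections => /=; first by rewrite IH; case: eqP.
case: i => [|i]; first by case: eqP.
case: j => [|j] //=; first by rewrite linear0.
by rewrite IH eqSS; case: eqP.
Qed.

Lemma kbot_khom_projS xs i (c : kos xs) : kbot (khom_proj i.+1 c) = 0.
Proof. by elim: xs c => [|x xs IH] c /=. Qed.

Lemma kin_khom_proj A xs i (c : kos xs) : A 0 -> kin A c -> kin A (khom_proj i c).
Proof.
move=> A0; have K0 ys : @kin A ys 0 by elim: ys => //=.
by elim: xs i c => [|x xs IH] [|i] c //= [c1 c2]; split=> //; exact: IH.
Qed.

Lemma khom_proj_sum xs (c : kos xs) : c = \sum_(i < (size xs).+1) khom_proj i c.
Proof.
elim: xs c => [|x xs IH] c; first by rewrite big_ord_recl big_ord0 addr0.
have khigh ys i (d : kos ys) : (size ys < i)%N -> khom_proj i d = 0.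
  elim: ys i d => [|y ys IHy] [|i] d //= lti.
  by apply: injective_projections => /=; apply: IHy => //; apply: ltnW.
apply: injective_projections => /=.
  rewrite (raddf_sum (fst : kos xs * kos xs -> kos xs)) big_ord_recr /=.
  by rewrite (khigh _ (size xs).+1) // addr0 -IH.
rewrite (raddf_sum (snd : kos xs * kos xs -> kos xs)) big_ord_recl /= add0r.
by rewrite [LHS]IH; apply: eq_bigr.
Qed.

End KoszulComplex.

Section KoszulMap.
Variables (S : comNzRingType) (M M' : lmodType S).
Implicit Types xs : seq S.

Fixpoint kmap (phi : M -> M') xs : kos M xs -> kos M' xs :=
  match xs return kos M xs -> kos M' xs with
  | [::] => phi
  | x :: xs' => fun c => (kmap phi c.1, kmap phi c.2)
  end.

Lemma kin_kmap phi (A : M' -> Prop) xs (c : kos M xs) :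
  kin A (kmap phi c) <-> kin (fun m => A (phi m)) c.
Proof.
by elim: xs c => [|x xs IH] c //=; split=> -[/IH ? /IH ?].
Qed.

Lemma kmap_kemb phi xs m : phi 0 = 0 -> kmap phi (kemb xs m) = kemb xs (phi m).
Proof.
move=> phi0; have K0 ys : kmap phi (0 : kos M ys) = 0.
  by elim: ys => [|y ys IH] //=; rewrite IH.
by elim: xs m => [|x xs IH] m //=; rewrite IH K0.
Qed.

Lemma kmap_khom_proj phi xs i (c : kos M xs) : phi 0 = 0 ->
  kmap phi (khom_proj i c) = khom_proj i (kmap phi c).
Proof.
move=> phi0; have K0 ys : kmap phi (0 : kos M ys) = 0.
  by elim: ys => [|y ys IH] //=; rewrite IH.
by elim: xs i c => [|x xs IH] [|i] c //=; rewrite ?IH ?K0.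
Qed.

Lemma kmapB phi xs : {morph phi : a b / a - b} ->
  {morph @kmap phi xs : c d / c - d}.
Proof.
by move=> phiB; elim: xs => [|x xs IH] c d //=; rewrite !IH.
Qed.

Lemma kin_kmap_lift phi (A : M' -> Prop) (B : M -> Prop) xs (c : kos M' xs) :
    (forall m, A m -> exists2 m', B m' & phi m' = m) ->
  kin A c -> exists2 c', kin B c' & kmap phi c' = c.
Proof.
move=> lift; elim: xs c => [|x xs IH]; first exact: lift.
by case=> c0 c1 /= [] /IH [d0 ? <-] /IH [d1 ? <-]; exists (d0, d1).
Qed.

Lemma kmap_kd (phi : {linear M -> M'}) xs (c : kos M xs) :
  kmap phi (kd c) = kd (kmap phi c).
Proof.
have kmapD ys : {morph @kmap phi ys : c d / c + d}.
  by elim: ys => [|y ys IH] d e /=; rewrite ?linearD ?IH.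
have kmapZ ys s : {morph @kmap phi ys : c / s *: c}.
  by elim: ys => [|y ys IH] d /=; rewrite ?linearZ ?IH.
have kmapN ys : {morph @kmap phi ys : c / - c}.
  by move=> d; rewrite -scaleN1r kmapZ scaleN1r.
by elim: xs c => [|x xs IH] c /=; rewrite ?linear0 // kmapD kmapZ kmapN !IH.
Qed.

End KoszulMap.

(** * Graded coefficients and exact sequences in Koszul homology *)

Section Graded.
Variables (S : comNzRingType) (X : seq S).

(** A grading is given by its projections. The ring carries no grading of its own: only the elements
    of [X] are required to act in degree 1. *)
Record grading (M : lmodType S) := Grading {
  grade_proj :> nat -> M -> M;
  grade_projB : forall e, {morph grade_proj e : a b / a - b};
  grade_proj_idem : forall e e' m,
    grade_proj e (grade_proj e' m) = if e == e' then grade_proj e m else 0;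
  grade_proj_sum : forall m, exists b, m = \sum_(e < b) grade_proj e m;
  grade_projX : forall x e m, x \in X ->
    grade_proj e.+1 (x *: m) = x *: grade_proj e m }.

Variables (M : lmodType S) (pr : grading M).
Implicit Types (A J : M -> Prop) (f : S).

Lemma grade_proj0 e : pr e 0 = 0.
Proof. by rewrite -{1}(subrr (0 : M)) grade_projB subrr. Qed.

Lemma grade_projD e : {morph pr e : a b / a + b}.
Proof.
by move=> a b; rewrite -{1}[b]opprK -[- b]sub0r !grade_projB grade_proj0 sub0r opprK.
Qed.

Definition graded e m := pr e m = m.

Lemma graded_subgroup e : subgroup (graded e).
Proof.
by split=> [|a b]; rewrite /graded ?grade_proj0 // grade_projB => -> ->.
Qed.

Lemma graded_proj e m : graded e (pr e m).
Proof. by rewrite /graded grade_proj_idem eqxx. Qed.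

Record graded_submodule A : Prop := GradedSubmodule {
  graded_submodule_sub :> submodule A;
  submodule_proj : forall e m, A m -> A (pr e m) }.

Lemma graded_sum_pred A J :
  graded_submodule A -> graded_submodule J -> graded_submodule (sum_pred A J).
Proof.
move=> gA gJ; split; first exact: (sum_pred_submodule gA gJ).
move=> e _ [a [b [Aa Jb ->]]]; rewrite grade_projD.
by exists (pr e a), (pr e b); split=> //; exact: submodule_proj.
Qed.

Definition kgrade e xs : kos M xs -> kos M xs := kmap (pr e) (xs := xs).

Lemma kgradeB e xs : {morph @kgrade e xs : c d / c - d}.
Proof. exact/kmapB/grade_projB. Qed.

Lemma kgrade0 e xs : @kgrade e xs 0 = 0.
Proof. by rewrite -{1}(subrr (0 : kos M xs)) kgradeB subrr. Qed.

Lemma kgradeD e xs : {morph @kgrade e xs : c d / c + d}.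
Proof.
by move=> a b; rewrite -{1}[b]opprK -[- b]sub0r !kgradeB kgrade0 sub0r opprK.
Qed.

Lemma kin_kgrade A e xs (c : kos M xs) :
  graded_submodule A -> kin A c -> kin A (kgrade e c).
Proof.
by move=> gA kA; apply/kin_kmap; apply: kin_mono kA => m; exact: submodule_proj.
Qed.

Lemma kin_gradedE e xs (c : kos M xs) : kin (graded e) c <-> kgrade e c = c.
Proof.
elim: xs c => [|x xs IH]; first by [].
by case=> c0 c1 /=; split=> [[/IH E0 /IH E1]|[/IH ? /IH ?]] //; congr (_, _).
Qed.

Lemma kgraded_kgrade e xs (c : kos M xs) : kin (graded e) (kgrade e c).
Proof.
by apply/kin_kmap; elim: xs c => [|x xs IH] c /=; [exact: graded_proj | split].
Qed.

Lemma kgradeZ f d e xs (c : kos M xs) :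
    (forall e m, pr (e + d)%N (f *: m) = f *: pr e m) ->
  kgrade (e + d)%N (f *: c) = f *: kgrade e c.
Proof.
move=> prf; elim: xs c => [|x xs IH] c /=; first exact: prf.
by apply: injective_projections; rewrite /= -IH.
Qed.

Lemma kgrade_kd e xs (c : kos M xs) : {subset xs <= X} ->
  kgrade e.+1 (kd c) = kd (kgrade e c).
Proof.
elim: xs c => [|x xs IH] c sX /=; first exact: grade_proj0.
have {}IH := IH _ (fun y ys => sX y (mem_behead (s := x :: xs) ys)).
have xX : x \in X by apply: sX; rewrite mem_head.
apply: injective_projections => /=; rewrite -!/(kgrade _ _).
  rewrite kgradeD IH -[e.+1]addn1 (kgradeZ (d := 1)) // => k m.
  by rewrite addn1 grade_projX.
by rewrite -[- kd _]sub0r kgradeB IH kgrade0 sub0r.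
Qed.

Lemma kgraded_kd e xs (c : kos M xs) : {subset xs <= X} ->
  kin (graded e) c -> kin (graded e.+1) (kd c).
Proof. by move=> sX /kin_gradedE gc; apply/kin_gradedE; rewrite kgrade_kd // gc. Qed.

(** Vanishing of all [H_i(X; M/J)_(i + e)]: the exterior generators have degree
    1, so [e] is the degree of the coefficients, and chains of mixed homological
    degree are harmless. *)
Definition koszul_vanish J e := forall z : kos M X,
  kin (graded e) z -> kin J (kd z) -> exists w : kos M X, kin J (z - kd w).

Lemma koszul_vanish_ext J J' e : (forall m, J m <-> J' m) ->
  koszul_vanish J e -> koszul_vanish J' e.
Proof.
move=> eqJ van z gz Jz; have [|w Jw] := van z gz.
  by apply: kin_mono Jz => m /eqJ.
by exists w; apply: kin_mono Jw => m /eqJ.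
Qed.

(** The differential raises the coefficient degree by one, so the degree [e] part of any bounding
    chain still bounds. *)
Lemma koszul_vanish_graded J e z : graded_submodule J ->
    koszul_vanish J e.+1 -> kin (graded e.+1) z -> kin J (kd z) ->
  exists2 w : kos M X, kin (graded e) w & kin J (z - kd w).
Proof.
move=> gJ van gz /(van z gz) [w Jw]; exists (kgrade e w); first exact: kgraded_kgrade.
have /kin_gradedE gz' := gz.
by rewrite -kgrade_kd // -{1}gz' -kgradeB; exact: kin_kgrade.
Qed.

Lemma kin_add_multiplesI J f xs (a b : kos M xs) :
  kin J a -> kin (add_multiples J f) (a + f *: b).
Proof.
elim: xs a b => [|x xs IH] a b /=; first by exists a, b.
by case=> ? ?; split; exact: IH.
Qed.

(** Long exact sequence of 0 -> (M/J)(-d) -> M/J -> M/(J + f M) -> 0. The term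
    H_(i-1)((M/J)(-d))_(i+e+d) is H_(i-1)(M/J)_(i-1+e+1), which explains the degree [e.+1]. *)
Lemma koszul_vanish_add_multiples J f d e : graded_submodule J ->
    (forall e m, pr (e + d)%N (f *: m) = f *: pr e m) ->
    nonzerodivisor_mod J f ->
    koszul_vanish J e.+1 -> koszul_vanish J (e + d)%N ->
  koszul_vanish (add_multiples J f) (e + d)%N.
Proof.
move=> gJ prf nzd van1 van2 z gz /kin_add_multiples [j [u [Jj dz]]].
have sJ : submodule J := gJ; have kJ := kin_submodule X sJ.
have gdz : kgrade (e + d).+1%N (kd z) = kd z.
  by apply/kin_gradedE; apply: kgraded_kd.
pose j' := kgrade (e + d).+1%N j; pose u' := kgrade e.+1 u.
have Jj' : kin J j' by apply: kin_kgrade.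
have {}dz : kd z = j' + f *: u' by rewrite -gdz dz kgradeD -addSn kgradeZ.
(* Applying the differential to the formula for [kd z] shows that [f *: kd u'] lies in J; cancelling
   [f] makes [u'] a cycle modulo J. *)
have Jdu : kin J (kd u').
  apply: kin_nonzerodivisor nzd _; rewrite -linearZ.
  have -> : f *: u' = kd z - j' by rewrite dz addrC addKr.
  rewrite linearB /= kd_kd sub0r; apply: (subgroupN kJ); exact: kin_kd.
have [w gw Jw] := koszul_vanish_graded gJ van1 (kgraded_kgrade _ _) Jdu.
have gfw : kin (graded (e + d)%N) (f *: w).
  by apply/kin_gradedE; rewrite kgradeZ //; move/kin_gradedE: gw => ->.
have [||w' Jw'] := van2 (z - f *: w).
- exact: (subgroupB (kin_subgroup _ (graded_subgroup _))).
- rewrite linearB linearZ /= dz -addrA -scalerBr.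
  by apply: (subgroupD kJ) => //; apply: (submoduleZ kJ).
exists w'; rewrite -[z](subrK (f *: w)) addrAC.
exact: kin_add_multiplesI.
Qed.

(* Multiplication by [x] is null-homotopic, so [H(M/J)] embeds in
   [H(M/(J + x M))]. *)
Lemma koszul_vanish_linear_nonzerodivisor J x e : submodule J ->
    x \in X -> nonzerodivisor_mod J x ->
  koszul_vanish (add_multiples J x) e -> koszul_vanish J e.
Proof.
move=> sJ xX nzd van z gz Jz; have kJ := kin_submodule X sJ.
have [|w /kin_add_multiples [j [u [Jj zw]]]] := van z gz.
  by rewrite -[kd z]addr0 -(scaler0 _ x); exact: kin_add_multiplesI.
have [h [_ hd hin]] := koszul_homotopy M xX.
have Jdu : kin J (kd u).
  apply: kin_nonzerodivisor nzd _; rewrite -linearZ.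
  have -> : x *: u = z - kd w - j by rewrite zw addrC addKr.
  rewrite !linearB /= kd_kd subr0; apply: (subgroupB kJ) => //; exact: kin_kd.
exists (w + h u); rewrite linearD /= hd opprD addrA zw opprB addrA.
rewrite [_ - x *: u]addrAC addrK.
by apply: (subgroupD kJ) => //; exact: (hin _ _ sJ).
Qed.

(* Multiplication by [f] is null-homotopic, so the connecting map
   [H_(i+1)(M/(J + f M)) -> H_i(M/J)] is onto. *)
Lemma koszul_vanish_quadric_nonzerodivisor J x1 x2 y1 y2 e : graded_submodule J ->
    x1 \in X -> x2 \in X -> y1 \in X -> y2 \in X ->
    let f := x1 * y1 - x2 * y2 in
    nonzerodivisor_mod J f ->
  koszul_vanish (add_multiples J f) e.+1 -> koszul_vanish J e.
Proof.
move=> gJ x1X x2X y1X y2X f nzd van z gz Jz; have sJ : submodule J := gJ; have kJ := kin_submodule X sJ.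
have [h1 [_ hd1 hin1]] := koszul_homotopy M x1X.
have [h2 [_ hd2 hin2]] := koszul_homotopy M x2X.
pose h c := y1 *: h1 c - y2 *: h2 c.
have hd c : kd (h c) = f *: c - h (kd c).
  rewrite /h linearB !linearZ /= hd1 hd2 !(scalerN, scalerBr) !scalerA scalerBl.
  by rewrite (mulrC y1) (mulrC y2) !(opprD, opprK) addrACA.
have hin c : kin J c -> kin J (h c).
  move=> Jc; apply: (subgroupB kJ); apply: (submoduleZ kJ).
    exact: (hin1 _ _ sJ).
  exact: (hin2 _ _ sJ).
have Z x c : x \in X -> kin (graded e) c -> kin (graded e.+1) (x *: c).
  move=> xX /kin_gradedE gc; apply/kin_gradedE.
  rewrite -addn1 (kgradeZ (d := 1)) ?gc // => k m.
  by rewrite addn1 grade_projX.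
have sge := graded_subgroup e.
have [||w /kin_add_multiples [j [u [Jj zw]]]] := van (h z).
- apply: (subgroupB (kin_subgroup _ (graded_subgroup _))); apply: Z => //.
    exact: (hin1 _ _ sge).
  exact: (hin2 _ _ sge).
- rewrite hd addrC; apply: kin_add_multiplesI; apply: (subgroupN kJ); exact: hin.
exists u; apply: kin_nonzerodivisor nzd _.
clearbody h; have /(congr1 (@kd _ _ _)) := zw.
rewrite linearB linearD linearZ /= kd_kd subr0 hd => E.
have -> : f *: (z - kd u) = kd j + h (kd z).
  by rewrite scalerBr -[f *: z](subrK (h (kd z))) E addrAC addrK.
by apply: (subgroupD kJ); [exact: kin_kd | exact: hin].
Qed.

(** Mayer-Vietoris: H_i(M/(I cap B))_(i+e+2) lies between H_(i+1)(M/(I + B))_(i+1+e+1) and the sum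
    of the two quotients' homology in degree i+e+2. This is why the sum is used one coefficient
    degree lower. *)
Lemma koszul_vanish_intersection I B e :
    graded_submodule I -> graded_submodule B ->
    koszul_vanish I e.+2 -> koszul_vanish B e.+2 -> koszul_vanish (sum_pred I B) e.+1 ->
  koszul_vanish (intersection I B) e.+2.
Proof.
move=> gI gB vI vB vS z gz dz.
have sI : submodule I := gI; have kI := kin_submodule X sI; have sB : submodule B := gB; have kB := kin_submodule X sB.
have [|w1 gw1 Iw1] := koszul_vanish_graded gI vI gz; first by apply: kin_mono dz => m [].
have [|w2 gw2 Bw2] := koszul_vanish_graded gB vB gz; first by apply: kin_mono dz => m [].
have sumI xs (a b : kos M xs) : kin I a -> kin B b -> kin (sum_pred I B) (a + b).
  elim: xs a b => [|x xs IH] a b /=; first by exists a, b.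
  by move=> [? ?] [? ?]; split; exact: IH.
(* [w1] and [w2] bound [z] modulo I and modulo B; their difference is a cycle modulo I + B, and its
   class is the obstruction to a common choice. *)
have [||u /kin_sum [i [b [Ii Bb E]]]] := vS (w1 - w2).
- exact: (subgroupB (kin_subgroup _ (graded_subgroup _))).
- have -> : kd (w1 - w2) = - (z - kd w1) + (z - kd w2).
    by rewrite linearB /= opprB addrA subrK.
  by apply: sumI => //; exact: (subgroupN kI).
exists (w1 - i); apply: kin_intersection.
  rewrite linearB /= opprB addrCA addrC.
  by apply: (subgroupD kI) => //; exact: kin_kd.
have -> : w1 - i = w2 + b + kd u.
  move/eqP: E; rewrite !subr_eq => /eqP ->.
  by rewrite addrC !addrA addNr add0r addrAC [b + w2]addrC.
have -> : kd (w2 + b + kd u) = kd w2 + kd b by rewrite !linearD /= kd_kd addr0.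
rewrite opprD addrA.
by apply: (subgroupB kB) => //; exact: kin_kd.
Qed.

(** The other part of Mayer-Vietoris, exact at the middle term, where all three quotients occur in
    the same degree. *)
Lemma koszul_vanish_summand I B e :
    graded_submodule I -> graded_submodule B ->
    koszul_vanish (intersection I B) e.+1 -> koszul_vanish (sum_pred I B) e.+1 ->
  koszul_vanish B e.+1.
Proof.
move=> gI gB vIB vS z gz dz.
have sI : submodule I := gI; have kI := kin_submodule X sI; have sB : submodule B := gB; have kB := kin_submodule X sB.
have gS := graded_sum_pred gI gB.
have [|w gw] := koszul_vanish_graded gS vS gz.
  apply: kin_mono dz => m Bm; exists 0, m; rewrite add0r; split=> //.
  exact: (subgroup0 gI).
move=> /kin_sum [i [b [Ii Bb E]]].
pose i' := kgrade e.+1 i; pose b' := kgrade e.+1 b.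
have Ii' : kin I i' by apply: kin_kgrade.
have Bb' : kin B b' by apply: kin_kgrade.
have {}E : z - kd w = i' + b'.
  rewrite -kgradeD -E kgradeB; move/kin_gradedE: gz => ->.
  by rewrite kgrade_kd //; move/kin_gradedE: gw => ->.
have [||w' Iw'] := vIB i'; first exact: kgraded_kgrade.
  apply: kin_intersection; first exact: kin_kd.
  have -> : i' = z - kd w - b' by rewrite E addrK.
  rewrite !linearB /= kd_kd subr0; apply: (subgroupB kB) => //; exact: kin_kd.
exists (w + w'); rewrite linearD /= opprD addrA E addrAC.
by apply: (subgroupD kB) => //; apply: kin_mono Iw' => m [].
Qed.

(** No [H_i(X; Z)_(i + e)], where [Z] is a submodule of [M]. *)
Definition koszul_vanish_at Z i e := forall z : kos M X,
  khom_proj i z = z -> kin Z z -> kin (graded e) z -> kd z = 0 ->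
  exists2 w : kos M X, kin Z w & kd w = z.

(** From 0 -> J -> M -> M/J -> 0: the connecting map H_(i+1)(M/J)_(i+1+e+1) -> H_i(J)_(i+e+2) is
    onto because the homology of M vanishes there. *)
Lemma koszul_vanish_at_quotient J e : graded_submodule J ->
    koszul_vanish (fun m => m = 0) e.+2 -> koszul_vanish J e.+1 ->
  forall i, koszul_vanish_at J i e.+2.
Proof.
move=> gJ v0 vJ i z _ Jz gz dz.
have g0 : graded_submodule (fun m => m = 0).
  split=> [|k m ->]; last exact: grade_proj0.
  by split=> [|s a ->]; [split=> // a b -> ->; exact: subr0 | exact: scaler0].
have [|w gw /kin_eq0 E] := koszul_vanish_graded g0 v0 gz; first exact/kin_eq0.
have {}E : kd w = z by apply/esym/eqP; rewrite -subr_eq0 E.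
have [|w' Jw'] := vJ w gw; first by rewrite E.
by exists (w - kd w') => //; rewrite linearB /= kd_kd subr0.
Qed.

Lemma koszul_vanish_quotient J e : graded_submodule J ->
    koszul_vanish (fun m => m = 0) e.+1 ->
    (forall i, koszul_vanish_at J i e.+2) ->
  koszul_vanish J e.+1.
Proof.
move=> gJ v0 vJ z gz Jdz.
have sJ : submodule J := gJ; have kJ := kin_submodule X sJ.
have gdz := kgraded_kd (fun _ => id) gz.
have [j Jj E] : exists2 j, kin J j & kd j = kd z.
  (* The hypothesis on J treats one homological degree at a time, so the boundary [kd z] is cut into
     its components and the bounding chains are added up. *)
  have piece i : exists2 j, kin J j & kd j = khom_proj i (kd z).
    apply: (vJ i).
    - by rewrite khom_proj_idem eqxx.
    - by apply: kin_khom_proj => //; exact: (subgroup0 gJ).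
    - by apply: kin_khom_proj => //; exact: grade_proj0.
    - case: i => [|i]; first by rewrite khom_proj0 kd_kemb.
      by rewrite kd_khom_proj kd_kd linear0.
  rewrite [kd z]khom_proj_sum; elim: (size X).+1 => [|k [j Jj E]].
    by exists 0; rewrite ?linear0 ?big_ord0 //; exact: (subgroup0 kJ).
  have [j' Jj' E'] := piece k; exists (j + j'); first exact: (subgroupD kJ).
  by rewrite linearD /= E E' big_ord_recr.
pose j' := kgrade e.+1 j.
have Jj' : kin J j' by apply: kin_kgrade.
have {}E : kd j' = kd z.
  by rewrite -kgrade_kd // E; move/kin_gradedE: gdz.
have [||w /kin_eq0 E'] := v0 (z - j').
- by apply: (subgroupB (kin_subgroup _ (graded_subgroup _))) => //; exact: kgraded_kgrade.
- by apply/kin_eq0; rewrite linearB /= E subrr.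
exists w; have -> : z - kd w = j' by apply/eqP; rewrite -subr_eq0 addrAC E'.
by [].
Qed.

Lemma koszul_vanish0 e : regular_sequence M X ->
    (forall m, graded e m -> combination X (fun=> True) m) ->
  koszul_vanish (fun m => m = 0) e.
Proof.
move=> reg comb z gz dz.
have [|w E] := koszul_acyclic reg (((kin_eq0 (kd z)).1 dz)).
  by apply: comb; exact: kin_kbot gz.
by exists w; apply/kin_eq0; rewrite E subrr.
Qed.

End Graded.

(** * Polynomials and graded free modules *)

Section KillVariable.
Variables (K : fieldType) (N : nat).
Local Notation S := {mpoly K[N]}.
Implicit Types (p q : S) (i j : 'I_N).

Definition kill i p : S := p \mPo [tuple if j == i then 0 else 'X_j | j < N].

HB.instance Definition _ i := GRing.RMorphism.copy (kill i)
  (fun p : S => p \mPo [tuple if j == i then 0 else 'X_j | j < N]).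

Lemma kill_var i j : kill i 'X_j = if j == i then 0 else 'X_j.
Proof. by rewrite /kill comp_mpolyXU -tnth_nth tnth_mktuple. Qed.

Lemma kill_mpolyX i m : kill i 'X_[m] = if m i == 0%N then 'X_[m] else 0.
Proof.
rewrite /kill comp_mpolyX; case: (eqVneq (m i) 0%N) => [m0|mi].
  rewrite [RHS]mpolyXE_id; apply: eq_bigr => j _; rewrite tnth_mktuple.
  by case: eqVneq => // ->; rewrite m0 !expr0.
by rewrite (bigD1 i) //= tnth_mktuple eqxx expr0n (negbTE mi) mul0r.
Qed.

Lemma killZ i c p : kill i (c *: p) = c *: kill i p.
Proof. exact: comp_mpolyZ. Qed.

(** Division by the variable with a remainder free of it. The drop in size of the quotient drives
    the induction in [edge_nonzerodivisor]. *)
Lemma kill_split i p :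
  exists2 q, p = kill i p + 'X_i * q & (msize q <= (msize p).-1)%N.
Proof.
have lem (m : 'X_{1..N}) : m i != 0%N -> (U_(i) <= m)%MM.
  by move=> mi; apply/mnm_lepP => j; rewrite mnm1E; case: eqVneq => // <-; rewrite lt0n.
exists (\sum_(m <- msupp p | m i != 0%N) p@_m *: 'X_[(m - U_(i))%MM]).
  rewrite {1 2}[p]mpolyE raddf_sum mulr_sumr [X in _ = _ + X]big_mkcond /= -big_split /=.
  apply: eq_bigr => m _; rewrite killZ kill_mpolyX.
  case: eqVneq => mi; first by rewrite addr0.
  by rewrite scaler0 add0r -scalerAr -mpolyXD addmC submK // lem.
rewrite (leq_trans (mmeasure_sum _ _ _ _)) //; apply/bigmax_leqP_seq => m mp mi.
rewrite (leq_trans (msizeZ_le _ _)) // msizeX -addn1 -(mdeg1 i) -mdegD submK ?lem //.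
by have /= := msize_mdeg_lt mp; case: (msize p).
Qed.

Lemma kill_idem i p : kill i (kill i p) = kill i p.
Proof.
have [q pE _] := kill_split i p.
by rewrite {2}pE rmorphD rmorphM /= kill_var eqxx mul0r addr0.
Qed.

End KillVariable.

Section VariableSequence.
Variables (K : fieldType) (N : nat).
Local Notation S := {mpoly K[N]}.
Implicit Types (p q : S) (i j : 'I_N) (js : seq 'I_N).

Fixpoint kill_all js : {rmorphism S -> S} :=
  if js is j :: js' then (kill_all js' \o @kill K N j)%FUN else idfun.

Lemma kill_all_var js i : kill_all js 'X_i = if i \in js then 0 else 'X_i.
Proof.
elim: js => [|j js IH] //=; rewrite kill_var inE.
by case: eqVneq => //= _; rewrite rmorph0.
Qed.

Lemma kill_all_enum p : p@_0 = 0 -> kill_all (enum 'I_N) p = 0.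
Proof.
move=> p0; have killC js c : kill_all js c%:MP = c%:MP.
  by elim: js => [|j js IH] //=; rewrite /kill comp_mpolyC IH.
rewrite [p]mpolyE raddf_sum /= big1 // => m _.
rewrite -mul_mpolyC rmorphM /= killC mpolyXE_id rmorph_prod /=.
case: (eqVneq m 0%MM) => [->|]; first by rewrite p0 mpolyC0 mul0r.
rewrite -mdeg_eq0 mdegE sum_nat_eq0 negb_forall => /existsP[i /= mi].
rewrite (bigD1 i) //= rmorphXn /= kill_all_var mem_enum /= expr0n (negbTE mi).
by rewrite mul0r mulr0.
Qed.

Variable r : nat.
Implicit Types (v : 'rV[S]_r).

Lemma combination_kill (f : {rmorphism S -> S}) js v : {in js, forall i, f 'X_i = 0} ->
  combination [seq 'X_i | i <- js] (fun=> True) v -> forall a, f (v 0 a) = 0.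
Proof.
elim: js v => [|j js IH] v fX /=; first by move=> -> a; rewrite mxE rmorph0.
move=> [u [w [_ cw ->]]] a; rewrite !mxE rmorphD rmorphM /= fX ?mem_head //.
rewrite mul0r add0r; apply: IH cw _ => i ijs.
by apply: fX; rewrite inE ijs orbT.
Qed.

Lemma kill_all_combination js v : (forall a, kill_all js (v 0 a) = 0) ->
  combination [seq 'X_i | i <- js] (fun=> True) v.
Proof.
elim: js v => [|j js IH] v /= kv.
  by apply/rowP => a; rewrite mxE; exact: kv.
have /fin_all_exists[q qP] : forall a, exists q, v 0 a = kill j (v 0 a) + 'X_j * q.
  by move=> a; have [q ? _] := kill_split j (v 0 a); exists q.
exists (\row_a q a), (\row_a kill j (v 0 a)); split=> //.
  by apply: IH => a; rewrite mxE.
by apply/rowP => a; rewrite !mxE addrC -qP.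
Qed.

(** Membership in the ideal of some variables is tested by setting them to 0. A distinct variable
    survives this substitution, and polynomials form a domain. *)
Lemma variables_regular js : uniq js ->
  regular_sequence 'rV[S]_r [seq 'X_i | i <- js].
Proof.
elim: js => [|j js IH] //= /andP[jjs /IH reg]; split=> // v cv.
apply: kill_all_combination => a.
have := combination_kill (f := kill_all js) _ cv a.
rewrite mxE rmorphM /= kill_all_var (negbTE jjs) => /(_ _)/eqP.
rewrite mulf_eq0 => /(_ _)/orP[]; last by move/eqP.
- by move=> i ijs; rewrite kill_all_var ijs.
- by move=> /eqP/(congr1 (mcoeff U_(j))); rewrite mcoeffX eqxx mcoeff0 => /eqP; rewrite oner_eq0.
Qed.

End VariableSequence.

Section RowGrading.
Variables (K : fieldType) (N : nat).
Local Notation S := {mpoly K[N]}.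

Definition variables : seq S := [seq 'X_i | i <- enum 'I_N].

Lemma mem_variables i : 'X_i \in variables.
Proof. by apply: map_f; rewrite mem_enum. Qed.

Lemma pihomog_idem d e (p : S) :
  pihomog mdeg d (pihomog mdeg e p) = if d == e then pihomog mdeg d p else 0.
Proof.
case: eqVneq => [->|de]; first exact: pihomog_id.
by apply: pihomog_ne0 (pihomogP _ _ _); rewrite eq_sym.
Qed.

Lemma pihomogM d e (p q : S) : q \is d.-homog ->
  pihomog mdeg (e + d) (q * p) = q * pihomog mdeg e p.
Proof.
move=> hq; have := pihomog_partitionE (leqnn (mmeasure mdeg p)).
move: (mmeasure mdeg p) => n E.
rewrite {1}E [in RHS]E mulr_sumr !raddf_sum /= mulr_sumr.
apply: eq_bigr => k _; rewrite pihomog_idem.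
have hqk : q * pihomog mdeg k p \is (k + d)%N.-homog.
  by rewrite addnC; apply: dhomogM => //; exact: pihomogP.
case: eqVneq => [->|ke]; first exact: pihomog_dE.
by rewrite mulr0; apply: pihomog_ne0 hqk; rewrite eqn_add2r eq_sym.
Qed.

Lemma pihomogM_low d e (p q : S) : q \is d.-homog -> (e < d)%N ->
  pihomog mdeg e (q * p) = 0.
Proof.
move=> hq led; rewrite (pihomog_partitionE (leqnn (mmeasure mdeg p))) mulr_sumr.
rewrite raddf_sum big1 //= => k _; apply: (pihomog_ne0 (d := (d + k)%N)).
  by rewrite neq_ltn orbC (leq_trans led) ?leq_addr.
by apply: dhomogM => //; exact: pihomogP.
Qed.

Variables (r : nat) (s : 'I_r -> nat).

(** Degree [e] part of the free module with summands S(- s a). The test keeps truncated subtraction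
    from producing degree 0 when [e < s a]. *)
Definition row_proj e (v : 'rV[S]_r) : 'rV[S]_r :=
  \row_a (if (s a <= e)%N then pihomog mdeg (e - s a) (v 0 a) else 0).

Lemma row_projB e : {morph row_proj e : u v / u - v}.
Proof.
by move=> u v; apply/rowP => a; rewrite !mxE; case: ifP => _; rewrite ?raddfB ?subr0.
Qed.

Lemma row_proj_idem e e' v :
  row_proj e (row_proj e' v) = if e == e' then row_proj e v else 0.
Proof.
apply/rowP => a; rewrite (fun_if (fun w : 'rV[S]_r => w 0 a)) !mxE.
case: (leqP (s a) e) => [le|lt]; last by case: ifP.
case: (leqP (s a) e') => [le'|lt'].
  by rewrite pihomog_idem; case: (eqVneq e e') => [->|ne]; rewrite ?eqxx // eqn_sub2rE ?(negbTE ne).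
by rewrite raddf0; case: eqP => // E; move: lt'; rewrite -E ltnNge le.
Qed.

Lemma row_proj_sum v : exists b, v = \sum_(e < b) row_proj e v.
Proof.
pose b := \max_a (s a + msize (v 0%R a))%N.
exists b; apply/rowP => a; rewrite summxE.
have leb : (s a + msize (v 0%R a) <= b)%N by exact: (leq_bigmax a).
have lenb : (msize (v 0%R a) <= b - s a)%N.
  by rewrite leq_subRL // (leq_trans (leq_addr _ _) leb).
rewrite -(subnKC (leq_trans (leq_addr _ _) leb)) big_split_ord /= big1 ?add0r.
  rewrite {1}(pihomog_partitionE lenb); apply: eq_bigr => e _.
  by rewrite mxE leq_addr addKn.
by move=> e _; rewrite mxE leqNgt ltn_ord.
Qed.

Lemma row_projM d e q v : q \is d.-homog -> row_proj (e + d) (q *: v) = q *: row_proj e v.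
Proof.
move=> hq; apply/rowP => a; rewrite !mxE.
case: (leqP (s a) e) => [le|lt].
  by rewrite (leq_trans le (leq_addr _ _)) -(pihomogM _ _ hq) -addnBAC.
rewrite mulr0; case: ifP => // le; apply: (pihomogM_low _ hq).
by rewrite ltn_subLR // ltn_add2r.
Qed.

Lemma variable_homog x : x \in variables -> x \is 1.-homog.
Proof. by case/mapP => i _ ->; rewrite dhomogX; apply/eqP; exact: mdeg1. Qed.

Definition row_grading : grading variables 'rV[S]_r.
Proof.
apply: (@Grading _ _ _ row_proj row_projB row_proj_idem row_proj_sum).
by move=> x e v /variable_homog hx; rewrite -(row_projM e v hx) addn1.
Defined.

Lemma row_gradingE e v : row_grading e v = row_proj e v. Proof. by []. Qed.

Lemma rows_regular : regular_sequence 'rV[S]_r variables.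
Proof. by apply: variables_regular; exact: enum_uniq. Qed.

Lemma combination_variablesP (v : 'rV[S]_r) :
  combination variables (fun=> True) v <-> forall a, (v 0 a)@_0 = 0.
Proof.
split=> [cv a|v0]; last by apply: kill_all_combination => a; exact: kill_all_enum.
suff: combination [seq 'X_i | i <- enum 'I_N] (fun=> True) v -> (v 0 a)@_0 = 0 by exact.
elim: (enum 'I_N) v {cv} => [|i js IH] v /=; first by move=> ->; rewrite mxE mcoeff0.
move=> [u [w [_ /IH cw ->]]]; rewrite !mxE mcoeffD cw addr0 rmorphM /=.
by rewrite mcoeffX -mdeg_eq0 mdeg1 mul0r.
Qed.

Lemma graded_constant e v a : graded row_grading e v -> s a != e -> (v 0 a)@_0 = 0.
Proof.
move=> <- sae; rewrite row_gradingE mxE; case: leqP => [le|_]; last exact: mcoeff0.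
apply: (dhomog_nemf_coeff (pihomogP mdeg _ _)); rewrite /= mdeg0 eq_sym subn_eq0.
by rewrite -ltnNge ltn_neqAle sae.
Qed.

(** In degree [s a] the coordinate [a] has polynomial degree 0. This isolates a unit coefficient
    when redundant generators are removed. *)
Lemma row_proj_constant v a : (row_grading (s a) v 0 a) = ((v 0 a)@_0)%:MP.
Proof.
rewrite row_gradingE mxE leqnn subnn.
have : (msize (pihomog mdeg 0 (v 0%R a)) <= 1)%N.
  apply: leq_trans (mmeasure_sum _ _ _ _) _; apply/bigmax_leqP_seq => m _ /eqP m0.
  by rewrite (leq_trans (msizeZ_le _ _)) // msizeX m0.
move/msize1_polyC => ->; congr (_%:MP).
have := pihomog_partitionE (leqnn (mmeasure mdeg (v 0 a))).
rewrite -(big_mkord xpredT (fun k => pihomog mdeg k (v 0 a))).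
case: (mmeasure mdeg (v 0 a)) => [|n E].
  by rewrite big_geq // => ->; rewrite !raddf0.
have high : (\sum_(k < n) pihomog mdeg k.+1 (v 0 a))@_0 = 0.
  rewrite raddf_sum /=; apply: big1 => k _.
  by apply: (dhomog_nemf_coeff (pihomogP mdeg _ _)); rewrite /= mdeg0.
by rewrite [in RHS]E big_mkord big_ord_recl mcoeffD high addr0.
Qed.

End RowGrading.

(** * Minimal resolutions *)

(** As long as the chosen rows do not span W, a missing vector of W is appended; the rank grows each
    time and is at most [d]. *)
Lemma finite_spanning_subset (K : fieldType) d (W : 'rV[K]_d -> Prop) :
  exists k (A : 'M[K]_(k, d)),
    (forall i, W (row i A)) /\ forall w, W w -> (w <= A)%MS.
Proof.
have extend n : forall k (A : 'M[K]_(k, d)), (forall i, W (row i A)) ->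
    (d - \rank A <= n)%N ->
  exists k' (A' : 'M[K]_(k', d)),
    (forall i, W (row i A')) /\ forall w, W w -> (w <= A')%MS.
  elim: n => [|n IH] k A WA rkA.
    exists k, A; split=> // w _; apply: submx_full.
    by rewrite /row_full eqn_leq rank_leq_col -subn_eq0 -leqn0.
  have [sub|] := pselect (forall w, W w -> (w <= A)%MS); first by exists k, A.
  move/existsNP => [w] /not_implyP [Ww wA].
  apply: (IH _ (col_mx A w)) => [i|].
    by rewrite -[i]splitK; case: (split i) => j; rewrite ?rowKu ?rowKd ?row_id //;
      rewrite [j]ord1 row_id.
  have lt : (\rank A < \rank (col_mx A w))%N.
    rewrite -addsmxE ltn_neqAle.
    rewrite mxrankS ?addsmxSl // andbT; apply: contra_notN wA => /eqP E.
    by apply: submx_trans (addsmxSr A w) _; rewrite -(geq_leqif (mxrank_leqif_sup (addsmxSl A w))) E.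
  by rewrite -ltnS (leq_trans _ rkA) // ltn_sub2l // (leq_trans lt) // rank_leq_col.
by apply: (extend d 0%N 0) => [[]|] //; rewrite mxrank0 subn0.
Qed.

(** * Minimal homogeneous generators of graded submodules *)

Section MinimalGenerators.
Variables (K : fieldType) (N : nat).
Local Notation S := {mpoly K[N]}.
Local Notation X := (@variables K N).

Lemma row_projZ r (s : 'I_r -> nat) d e (p : S) (w : 'rV[S]_r) :
  graded (row_grading K N s) d w ->
  row_proj s e (p *: w) = if (d <= e)%N then pihomog mdeg (e - d) p *: w else 0.
Proof.
move=> gw; apply/rowP => b; rewrite (fun_if (fun v : 'rV[S]_r => v 0 b)) !mxE.
have : w 0 b = if (s b <= d)%N then pihomog mdeg (d - s b) (w 0 b) else 0.
  by rewrite -{1}gw row_gradingE mxE.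
case: (leqP (s b) d) => [sd|ds] wb; last first.
  by rewrite wb !mulr0 raddf0; case: ifP; case: ifP.
have hw : w 0 b \is (d - s b)%N.-homog by rewrite wb; exact: pihomogP.
case: (leqP d e) => [de|ed].
  by rewrite (leq_trans sd de) mulrC [in RHS]mulrC -(pihomogM _ _ hw) addnBA // subnK.
case: ifP => // se; rewrite mulrC; apply: (pihomogM_low _ hw).
exact: ltn_sub2r (leq_ltn_trans se ed) ed.
Qed.

Section Generators.
Variables (r : nat) (s : 'I_r -> nat) (Z : 'rV[S]_r -> Prop).

Definition homogeneous_rows r' (s' : 'I_r' -> nat) (D : 'M[S]_(r', r)) :=
  forall a, graded (row_grading K N s) (s' a) (row a D).

Definition generates r' (D : 'M[S]_(r', r)) :=
  forall v, Z v <-> exists u : 'rV[S]_r', v = u *m D.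

(** Relations lie in X F, with F the free module on the rows; for homogeneous rows this is
    minimality, by graded Nakayama. *)
Definition minimal_rows r' (D : 'M[S]_(r', r)) :=
  forall u : 'rV[S]_r', u *m D = 0 -> forall a, (u 0 a)@_0 = 0.

Lemma row_proj_mulmx r' (s' : 'I_r' -> nat) (D : 'M[S]_(r', r)) e u :
  homogeneous_rows s' D -> row_proj s e (u *m D) = row_proj s' e u *m D.
Proof.
move=> hD; rewrite !mulmx_sum_row -!row_gradingE.
have sumE (F : 'I_r' -> 'rV[S]_r) :
    row_grading K N s e (\sum_a F a) = \sum_a row_grading K N s e (F a).
  by apply: big_morph; [exact: grade_projD | exact: grade_proj0].
rewrite sumE; apply: eq_bigr => a _; rewrite row_gradingE (row_projZ _ _ (hD a)) mxE.
by case: ifP => // _; rewrite scale0r.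
Qed.

Hypothesis gZ : graded_submodule (row_grading K N s) Z.

(** As shifts are nonnegative, the entries of a row of degree [e] have degree at most [e]; finitely
    many coefficients determine it, so a basis argument over the field applies. *)
Lemma graded_piece_spanned e : exists k (L : 'M[S]_(k, r)),
  [/\ forall i, Z (row i L), homogeneous_rows (fun=> e) L &
      forall z, Z z -> graded (row_grading K N s) e z -> exists u, z = u *m L].
Proof.
pose T : finType := ('I_r * 'X_{1..N < e.+1})%type.
pose ev (t : 'I_#|T|) : ('I_r * 'X_{1..N < e.+1})%type := enum_val t.
pose enc (z : 'rV[S]_r) : 'rV[K]_#|T| := \row_t (z 0 (ev t).1)@_((ev t).2).
have encB y z : enc (y - z) = enc y - enc z.
  by apply/rowP => t; rewrite !mxE mcoeffB.
have enc_sum k (u : 'rV[K]_k) (F : 'I_k -> 'rV[S]_r) :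
    enc (\sum_i (u 0 i)%:MP *: F i) = \sum_i u 0 i *: enc (F i).
  apply/rowP => t; rewrite mxE !summxE raddf_sum /=.
  by apply: eq_bigr => i _; rewrite !mxE mcoeffCM.
have enc_inj z : graded (row_grading K N s) e z -> enc z = 0 -> z = 0.
  move=> gz ez; apply/rowP => b; rewrite mxE; apply/mpolyP => m; rewrite mcoeff0.
  case: (leqP (mdeg m) e) => [me|em].
    have /rowP/(_ (enum_rank ((b, BMultinom (bound := e.+1) me) : T))) := ez.
    by rewrite !mxE /ev enum_rankK.
  rewrite -gz row_gradingE mxE; case: ifP => _; last exact: mcoeff0.
  apply: (dhomog_nemf_coeff (pihomogP mdeg _ _)).
  by rewrite /= neq_ltn (leq_ltn_trans (leq_subr _ _) em) orbT.
have [k [A [WA spanA]]] := finite_spanning_subset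
  (fun w => exists z, [/\ Z z, graded (row_grading K N s) e z & w = enc z]).
have [z zP] := fin_all_exists WA.
exists k, (\matrix_i z i); split=> [i|i|y Zy gy].
- by rewrite rowK; case: (zP i).
- by rewrite /= rowK; case: (zP i).
have /submxP [u uE] : (enc y <= A)%MS by apply: spanA; exists y.
exists (map_mx (@mpolyC N K) u); rewrite mulmx_sum_row; apply/eqP; rewrite -subr_eq0.
apply/eqP/enc_inj.
  apply: (subgroupB (graded_subgroup _ e)) => //.
  apply: (big_ind (graded (row_grading K N s) e)).
  - exact: (subgroup0 (graded_subgroup _ e)).
  - by move=> a b ga gb; exact: (subgroupD (graded_subgroup _ e)).
  - move=> i _; rewrite rowK !mxE; have [_ gi _] := zP i.
    have h0 : ((u 0 i)%:MP : S) \is 0.-homog by rewrite -[X in X \is _]mulr1 mul_mpolyC; apply/dhomogZ/dhomog1.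
    by rewrite /graded row_gradingE -{1}[e]addn0 (row_projM _ _ _ h0) -row_gradingE gi.
rewrite encB (eq_bigr (fun i => (u 0 i)%:MP *: z i)); last first.
  by move=> i _; rewrite rowK !mxE.
rewrite enc_sum uE mulmx_sum_row; apply/eqP; rewrite subr_eq0; apply/eqP.
by apply: eq_bigr => i _; have [_ _ ->] := zP i.
Qed.

Lemma low_degrees_spanned n : exists k (L : 'M[S]_(k, r)) (s' : 'I_k -> nat),
  [/\ forall i, Z (row i L), homogeneous_rows s' L &
      forall e z, (e < n)%N -> Z z -> graded (row_grading K N s) e z ->
      exists u, z = u *m L].
Proof.
elim: n => [|n [k [L [s' [ZL hL spanL]]]]].
  by exists 0%N, 0, (fun=> 0%N); split=> [[]|[]|].
have [k' [L' [ZL' hL' spanL']]] := graded_piece_spanned n.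
exists (k + k')%N, (col_mx L L'), (fun i => if split i is inl j then s' j else n).
split=> [i|i|e z].
- by rewrite -[i]splitK; case: (split i) => j; rewrite ?rowKu ?rowKd.
- rewrite -{2}[i]splitK; case: (split i) => j; rewrite ?rowKu ?rowKd.
    exact: hL.
  exact: hL'.
rewrite ltnS leq_eqVlt => /predU1P[->|lt] Zz gz.
  have [u ->] := spanL' z Zz gz; exists (row_mx 0 u).
  by rewrite mul_row_col mul0mx add0r.
have [u ->] := spanL e z lt Zz gz; exists (row_mx u 0).
by rewrite mul_row_col mul0mx addr0.
Qed.

Lemma combination_sub (A : 'rV[S]_r -> Prop) xs v :
  submodule A -> combination xs A v -> A v.
Proof.
move=> sA; elim: xs v => [|x xs IH] v /=; first by move=> ->; exact: (subgroup0 sA).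
move=> [a [b [Aa /IH Ab ->]]]; apply: (subgroupD sA) => //; exact: submoduleZ.
Qed.

(* Graded Nakayama: [Z/XZ] lives in degrees below [n]. *)
Lemma finite_generators n :
    (forall e, (n <= e)%N -> koszul_vanish_at (row_grading K N s) Z 0 e) ->
  exists k (L : 'M[S]_(k, r)) (s' : 'I_k -> nat),
    homogeneous_rows s' L /\ generates L.
Proof.
move=> van; have sZ : submodule Z := gZ.
have [k [L [s' [ZL hL spanL]]]] := low_degrees_spanned n.+1.
have sL : submodule (fun v : 'rV[S]_r => exists u : 'rV[S]_k, v = u *m L).
  split; first split.
  - by exists 0; rewrite mul0mx.
  - by move=> _ _ [u ->] [u' ->]; exists (u - u'); rewrite mulmxBl.
  - by move=> p _ [u ->]; exists (p *: u); rewrite -scalemxAl.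
have span e z : Z z -> graded (row_grading K N s) e z -> exists u, z = u *m L.
  elim/ltn_ind: e z => e IH z Zz gz.
  case: (leqP e n) => [le|lt]; first by apply: (spanL e).
  case: e lt gz IH => // e lt gz IH.
  (* Vanishing of H_0 in degree [e.+1] writes [z] as a combination of variables with coefficients in
     Z; these can be taken of degree [e], where the induction hypothesis holds. *)
  have [||||w Zw dw] := van e.+1 (ltnW lt) (kemb X z).
  - by rewrite khom_proj0 kbot_kemb.
  - exact: (kin_kemb _ sZ).
  - exact: (kin_kemb _ (graded_subgroup _ _)).
  - exact: kd_kemb.
  have Zw' : kin (intersection Z (graded (row_grading K N s) e))
      (kgrade (row_grading K N s) e w).
    by apply: kin_intersection; [exact: kin_kgrade | exact: kgraded_kgrade].
  have dw' : kd (kgrade (row_grading K N s) e w) = kemb X z.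
    rewrite -kgrade_kd // dw /kgrade kmap_kemb ?gz //.
    exact: grade_proj0.
  have := kbot_kd Zw'; rewrite dw' kbot_kemb => cz.
  apply: (combination_sub (xs := X) sL); apply: combination_mono cz => v [Zv gv].
  exact: (IH e).
exists k, L, s'; split=> // v; split=> [Zv|[u ->]].
  have [b ->] := grade_proj_sum (row_grading K N s) v.
  apply: (big_ind (fun v => exists u : 'rV[S]_k, v = u *m L)).
  - exact: (subgroup0 sL).
  - by move=> x y; exact: (subgroupD sL).
  - move=> e _; apply: (span e); last exact: graded_proj.
    exact: submodule_proj.
rewrite mulmx_sum_row; apply: (big_ind Z).
- exact: (subgroup0 sZ).
- by move=> x y; exact: (subgroupD sZ).
- by move=> i _; exact: (submoduleZ sZ).
Qed.

(** A relation with a nonzero constant coefficient expresses one generator through the others;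
    dropping it lowers the number of rows. *)
Lemma minimal_generators k (L : 'M[S]_(k, r)) (s' : 'I_k -> nat) :
    homogeneous_rows s' L -> generates L ->
  exists k' (L' : 'M[S]_(k', r)) (s'' : 'I_k' -> nat),
    [/\ homogeneous_rows s'' L', generates L' & minimal_rows L'].
Proof.
elim: k L s' => [|k IH] L s' hL gL.
  by exists 0%N, L, s'; split=> // u _ [].
have [minL|] := pselect (minimal_rows L); first by exists k.+1, L, s'.
move/existsNP => [v /not_implyP [vL /existsNP [a /eqP va]]].
(* The component of degree [s' a] is still a relation, and its coordinate [a] is now exactly the
   nonzero constant. *)
pose u := row_grading K N s' (s' a) v.
have uL : u *m L = 0.
  rewrite /u row_gradingE -(row_proj_mulmx _ _ hL) vL.
  exact: (grade_proj0 (row_grading K N s)).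
have ua : u 0 a = ((v 0 a)@_0)%:MP by rewrite /u row_proj_constant.
set c := (v 0 a)@_0 in va ua; clearbody u.
apply: (IH (row' a L) (fun i => s' (lift a i))) => [i|w].
  have -> : row i (row' a L) = row (lift a i) L by apply/rowP => j; rewrite !mxE.
  exact: hL.
have drop_row (y : 'rV[S]_k.+1) : y 0 a = 0 -> y *m L = col' a y *m row' a L.
  move=> y0; rewrite !mulmx_sum_row (bigD1_ord a) //= y0 scale0r add0r.
  apply: eq_bigr => i _; rewrite mxE; congr (_ *: _).
  by apply/rowP => j; rewrite !mxE.
split=> [/gL [y ->]|[y ->]].
  (* Subtracting this multiple of the relation clears coordinate [a] without changing the image. *)
  pose y' := y - (y 0 a * (c^-1)%:MP) *: u.
  have -> : y *m L = y' *m L by rewrite mulmxBl -scalemxAl uL scaler0 subr0.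
  exists (col' a y'); apply: drop_row.
  by rewrite !mxE ua -mulrA -mpolyCM mulVf // mpolyC1 mulr1 subrr.
apply/gL; exists (\row_j if unlift a j is Some i then y 0 i else 0).
rewrite drop_row ?mxE ?unlift_none //; congr (_ *m _).
by apply/rowP => i; rewrite !mxE liftK.
Qed.

End Generators.
End MinimalGenerators.

(** * Dimension shifting through a minimal presentation *)

Section Syzygies.
Variables (K : fieldType) (N : nat).
Local Notation S := {mpoly K[N]}.
Local Notation X := (@variables K N).
Variables (r : nat) (s : 'I_r -> nat) (Z : 'rV[S]_r -> Prop).
Variables (r' : nat) (s' : 'I_r' -> nat) (D : 'M[S]_(r', r)).
Hypotheses (gZ : graded_submodule (row_grading K N s) Z).
Hypotheses (hD : homogeneous_rows s s' D) (genD : generates Z D) (minD : minimal_rows D).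

Definition row_kernel (u : 'rV[S]_r') := u *m D = 0.

Lemma row_kernel_graded : graded_submodule (row_grading K N s') row_kernel.
Proof.
rewrite /row_kernel; split=> [|e u uD]; last first.
  rewrite row_gradingE -(row_proj_mulmx _ _ hD) uD.
  exact: (grade_proj0 (row_grading K N s)).
split=> [|p u uD]; last by rewrite -scalemxAl uD scaler0.
by split=> [|u v uD vD]; rewrite ?mul0mx // mulmxBl uD vD subrr.
Qed.

Let phi : {linear 'rV[S]_r' -> 'rV[S]_r} := mulmxr D.

Let phi_grade e xs (c : kos 'rV[S]_r' xs) :
  kmap phi (kgrade (row_grading K N s') e c) =
  kgrade (row_grading K N s) e (kmap phi c).
Proof.
elim: xs c => [|x xs IH] c; first exact: (esym (row_proj_mulmx e c hD)).
by apply: injective_projections; exact: IH.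
Qed.

Let kin_Z xs (c : kos 'rV[S]_r' xs) : kin Z (kmap phi c).
Proof.
apply/kin_kmap; apply: kin_mono (kin_true c) => u _.
by apply/genD; exists u.
Qed.

Let lift_Z xs (c : kos 'rV[S]_r xs) : kin Z c -> exists c', kmap phi c' = c.
Proof.
move=> Zc; have [m /genD [u ->]|c' _ <-] := kin_kmap_lift (B := fun=> True) (phi := phi) _ Zc.
  by exists u.
by exists c'.
Qed.

Let kin_kernel xs (c : kos 'rV[S]_r' xs) : kmap phi c = 0 -> kin row_kernel c.
Proof. by move/kin_eq0/kin_kmap. Qed.

Let kernel_kin xs (c : kos 'rV[S]_r' xs) : kin row_kernel c -> kmap phi c = 0.
Proof. by move=> kc; apply/kin_eq0/kin_kmap. Qed.

Let acyclic (c : kos 'rV[S]_r' X) : kd c = 0 ->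
  (forall a, (kbot c 0 a)@_0 = 0) -> exists w, kd w = c.
Proof.
by move=> dc c0; apply: koszul_acyclic => //; [exact: rows_regular | exact/combination_variablesP].
Qed.

(* Dimension shifting along [0 -> ker -> F -> Z -> 0]; minimality gives the case
   [i = 0], where [H_0(ker) -> H_0(F)] must vanish. *)
Lemma koszul_vanish_at_kernel i e :
  koszul_vanish_at (row_grading K N s) Z i.+1 e <->
  koszul_vanish_at (row_grading K N s') row_kernel i e.+1.
Proof.
have kmB := kmapB (phi := phi) (raddfB phi).
split=> van z hz kz gz dz.
  (* By minimality the bottom component of a chain in the kernel has no constant terms, so the cycle
     bounds in F; the image of the bounding chain is then a cycle in Z. *)
  have [|w dw] := acyclic dz.
    by move=> a; apply: minD; exact: kin_kbot kz.
  pose w' := khom_proj i.+1 (kgrade (row_grading K N s') e w).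
  have dw' : kd w' = z.
    rewrite kd_khom_proj -kgrade_kd // dw -{2}hz; congr khom_proj.
    exact/kin_gradedE.
  have [||||u Zu du] := van (kmap phi w').
  - by rewrite -kmap_khom_proj ?linear0 // khom_proj_idem eqxx.
  - exact: kin_Z.
  - apply/kin_kmap; apply: (@kin_mono _ _ (graded (row_grading K N s') e)).
      by move=> u gu; rewrite /graded row_gradingE (row_proj_mulmx _ _ hD) -row_gradingE gu.
    by apply: kin_khom_proj; [exact: grade_proj0 | exact: kgraded_kgrade].
  - by rewrite -kmap_kd dw' kernel_kin.
  have [u' u'E] := lift_Z Zu.
  exists (w' - kd u'); last by rewrite linearB /= kd_kd subr0.
  by apply: kin_kernel; rewrite kmB kmap_kd u'E du subrr.
have [z1 z1E] := lift_Z kz.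
pose z' := khom_proj i.+1 (kgrade (row_grading K N s') e z1).
have z'E : kmap phi z' = z.
  rewrite kmap_khom_proj ?linear0 // phi_grade z1E -[RHS]hz; congr khom_proj.
  exact/kin_gradedE.
have [||||u ku du] := van (kd z').
- by rewrite -kd_khom_proj /z' khom_proj_idem eqxx.
- by apply: kin_kernel; rewrite kmap_kd z'E.
- apply: kgraded_kd => //; apply: kin_khom_proj; first exact: grade_proj0.
  exact: kgraded_kgrade.
- exact: kd_kd.
have [||w dw] := acyclic (c := z' - u).
- by rewrite linearB /= du subrr.
- move=> a; rewrite kbotB kbot_khom_projS sub0r mxE mcoeffN.
  by rewrite (minD (kin_kbot ku)) oppr0.
exists (kmap phi w); first exact: kin_Z.
by rewrite -kmap_kd dw kmB z'E kernel_kin // subr0.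
Qed.

(** H_0(X; Z) is Z/XZ, and the classes of minimal generators form a basis of it. *)
Lemma generator_degreeP e :
  (exists a, s' a = e) <-> ~ koszul_vanish_at (row_grading K N s) Z 0 e.
Proof.
have sZ : submodule Z := gZ.
split=> [[a sa] van|nvan].
  pose d : 'rV[S]_r' := delta_mx 0 a.
  have Zd : Z (phi d) by apply/genD; exists d.
  have [||||w Zw dw] := van (kemb X (phi d)).
  - by rewrite khom_proj0 kbot_kemb.
  - exact: (kin_kemb X sZ Zd).
  - apply: (kin_kemb _ (graded_subgroup _ _)).
    by rewrite /phi /= -rowE -sa; exact: hD.
  - exact: kd_kemb.
  have [w' w'E] := lift_Z Zw.
  have cd : combination X (fun=> True) (kbot (kd w')) by apply: kbot_kd; exact: kin_true.
  (* If the class of generator [a] vanished, this would be a relation with constant coefficient 1 at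
     [a], against minimality. *)
  have : row_kernel (d - kbot (kd w')).
    rewrite /row_kernel; change (phi (d - kbot (kd w')) = 0).
    have kbot_phi xs (c : kos 'rV[S]_r' xs) : phi (kbot c) = kbot (kmap phi c).
      by elim: xs c => [|x xs IH] c //=; exact: IH.
    by rewrite linearB kbot_phi kmap_kd w'E dw kbot_kemb subrr.
  move/minD/(_ a); rewrite !mxE !eqxx mcoeffB mcoeff1 eqxx.
  move/combination_variablesP: cd => ->.
  by rewrite subr0 => /eqP; rewrite oner_eq0.
apply: contrapT => noa; apply: nvan => z hz Zz gz dz.
have zE : z = kemb X (kbot z) by rewrite -khom_proj0 hz.
have [u1 u1E] : exists u, kbot z = u *m D by apply/genD; exact: kin_kbot Zz.
pose u := row_grading K N s' e u1.
have uE : phi u = kbot z.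
  by rewrite /phi /= /u row_gradingE -(row_proj_mulmx _ _ hD) -u1E; exact: (kin_kbot gz).
have [|w dw] := acyclic (c := kemb X u) (kd_kemb _ _).
  move=> a; rewrite kbot_kemb; apply: (graded_constant (graded_proj _ _ _)).
  by apply/eqP => sa; apply: noa; exists a.
exists (kmap phi w); first exact: kin_Z.
by rewrite -kmap_kd dw kmap_kemb ?linear0 // uE -zE.
Qed.

End Syzygies.

(** * Regularity from Koszul homology *)

Section Regularity.
Variables (K : fieldType) (N : nat).
Local Notation S := {mpoly K[N]}.
Local Notation X := (@variables K N).

(** Viewing an ideal inside the free module of rank 1 lets it serve as the first term of the chain
    of syzygy modules. *)
Definition ideal_row (I : S -> Prop) : 'rV[S]_1 -> Prop := fun v => I (v 0 0).

Local Notation ideal_grading := (row_grading K N (fun=> 0%N) : grading X 'rV[S]_1).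
Local Notation vanish I := (koszul_vanish_at ideal_grading (ideal_row I)).

Section ResolutionShifts.
Variables (I : S -> Prop) (F : graded_free_resolution I).
Hypotheses (gI : graded_submodule ideal_grading (ideal_row I)).
Hypothesis minF : minimal_resolution F.

Lemma aug_homogeneous : homogeneous_rows (fun=> 0%N) (@res_shift _ _ _ F 0) (res_aug F).
Proof.
move=> a; rewrite /graded row_gradingE; apply/rowP => b.
rewrite [b]ord1 !mxE /= subn0; apply: pihomog_dE.
exact: res_aug_homog.
Qed.

Lemma diff_homogeneous i :
  homogeneous_rows (@res_shift _ _ _ F i) (@res_shift _ _ _ F i.+1) (res_diff F i).
Proof.
move=> a; rewrite /graded row_gradingE; apply/rowP => b; rewrite !mxE.
case: (res_diff_homog a b) => [->|[e -> he]]; first by rewrite raddf0 if_same.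
by rewrite leq_addr addKn; exact: pihomog_dE.
Qed.

Lemma aug_generates : generates (ideal_row I) (res_aug F).
Proof.
move=> v; rewrite /ideal_row; split=> [/(res_aug_image F) [u uE]|[u ->]].
  by exists u; apply/rowP => b; rewrite [b]ord1.
by apply/(res_aug_image F); exists u.
Qed.

Lemma diff_generates0 : generates (row_kernel (res_aug F)) (res_diff F 0).
Proof. by move=> v; exact: res_exact0. Qed.

Lemma diff_generatesS i : generates (row_kernel (res_diff F i)) (res_diff F i.+1).
Proof. by move=> v; exact: res_exactS. Qed.

Let diff_image i (w : 'rV[S]_(res_rank F i.+1)) a :
  ((w *m res_diff F i) 0 a)@_0 = 0.
Proof.
rewrite mxE raddf_sum big1 // => b _ /=.
by rewrite rmorphM /= (minF b a) mulr0.
Qed.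

Lemma aug_minimal : minimal_rows (res_aug F).
Proof. by move=> u /res_exact0 [w ->]; exact: diff_image. Qed.

Lemma diff_minimal i : minimal_rows (res_diff F i).
Proof. by move=> u /res_exactS [w ->]; exact: diff_image. Qed.

Let kernel_graded i :
  graded_submodule (row_grading K N (@res_shift _ _ _ F i.+1)) (row_kernel (res_diff F i)).
Proof. exact: (row_kernel_graded (@diff_homogeneous i)). Qed.

(** The kernel of [res_diff F i] is reached from I by [i.+2] syzygy steps, each trading one
    homological degree for one coefficient degree. *)
Lemma kernel_vanish i j e :
  vanish I (j + i).+2 e <->
  koszul_vanish_at (row_grading K N (@res_shift _ _ _ F i.+1))
    (row_kernel (res_diff F i)) j (e + i).+2.
Proof.
elim: i j => [|i IH] j.
  rewrite addn0 -(koszul_vanish_at_kernel (@diff_homogeneous 0) diff_generates0 (diff_minimal (i := 0))).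
  by rewrite addn0; exact: (koszul_vanish_at_kernel aug_homogeneous aug_generates aug_minimal).
rewrite addnS -addSn addnS.
rewrite -(koszul_vanish_at_kernel (@diff_homogeneous i.+1) (diff_generatesS (i := i)) (diff_minimal (i := i.+1))).
exact: IH.
Qed.

Lemma shift_occursP i e :
  (exists a : 'I_(res_rank F i), res_shift a = (e + i)%N) <-> ~ vanish I i e.
Proof.
case: i => [|[|i]].
- rewrite addn0; exact: (generator_degreeP gI aug_homogeneous aug_generates aug_minimal).
- rewrite addn1.
  have := generator_degreeP (row_kernel_graded aug_homogeneous) (@diff_homogeneous 0)
    diff_generates0 (diff_minimal (i := 0)) e.+1.
  by move=> ->; rewrite -(koszul_vanish_at_kernel aug_homogeneous aug_generates aug_minimal).
rewrite !addnS.
rewrite (generator_degreeP (kernel_graded i) (@diff_homogeneous i.+1)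
  (diff_generatesS (i := i)) (diff_minimal (i := i.+1)) (e + i).+2).
by rewrite -kernel_vanish add0n.
Qed.

End ResolutionShifts.

(** Rank, shifts and predicate change together at each syzygy step, so they are bundled to allow
    iteration. The bound in [syz_vanish], uniform in [i], is the invariant that makes every syzygy
    module finitely generated. *)
Record syzygy_module := SyzygyModule {
  syz_rank : nat;
  syz_shift : 'I_syz_rank -> nat;
  syz_pred : 'rV[S]_syz_rank -> Prop;
  syz_graded : graded_submodule (row_grading K N syz_shift) syz_pred;
  syz_vanish : exists n, forall i e, (n <= e)%N ->
    koszul_vanish_at (row_grading K N syz_shift) syz_pred i e }.

Record minimal_generation (A : syzygy_module) := MinimalGeneration {
  gen_rank : nat;
  gen_shift : 'I_gen_rank -> nat;
  gen_rows : 'M[S]_(gen_rank, syz_rank A);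
  gen_homog : homogeneous_rows (@syz_shift A) gen_shift gen_rows;
  gen_generates : generates (@syz_pred A) gen_rows;
  gen_minimal : minimal_rows gen_rows }.

Lemma minimal_generation_exists A : exists g : minimal_generation A, True.
Proof.
have gA := syz_graded A; have [n van] := syz_vanish A.
have [k [L [s' [hL gL]]]] := finite_generators gA (van 0%N).
have [k' [L' [s'' [hL' gL' mL']]]] := minimal_generators hL gL.
by exists (MinimalGeneration hL' gL' mL').
Qed.

Definition minimal_gens A : minimal_generation A :=
  projT1 (cid (minimal_generation_exists A)).

Lemma next_syzygy_vanish A (g := minimal_gens A) :
  exists n, forall i e, (n <= e)%N ->
    koszul_vanish_at (row_grading K N (@gen_shift _ g)) (row_kernel (gen_rows g)) i e.
Proof.
have [n van] := syz_vanish A; exists n.+1 => i [|e] // le.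
apply: (koszul_vanish_at_kernel (@gen_homog _ g) (@gen_generates _ g) (@gen_minimal _ g) i e).1.
exact: van.
Qed.

Definition next_syzygy A : syzygy_module :=
  SyzygyModule (row_kernel_graded (@gen_homog _ (minimal_gens A))) (next_syzygy_vanish A).

Section Existence.
Variable I : S -> Prop.
Hypothesis gI : graded_submodule ideal_grading (ideal_row I).
Hypothesis vI : exists n, forall i e, (n <= e)%N -> vanish I i e.

Definition syzygy i := iter i next_syzygy (SyzygyModule gI vI).

Lemma gen_entry_homog A (g : minimal_generation A) a b :
  gen_rows g a b = 0 \/ exists2 e, gen_shift a = (syz_shift b + e)%N &
    gen_rows g a b \is e.-homog.
Proof.
have /rowP/(_ b) := @gen_homog _ g a; rewrite row_gradingE !mxE.
case: leqP => [le|_] <-; last by left.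
right; exists (gen_shift a - syz_shift b)%N; first by rewrite subnKC.
exact: pihomogP.
Qed.

Lemma gen_aug_homog (a : 'I_(gen_rank (minimal_gens (syzygy 0)))) :
  gen_rows (minimal_gens (syzygy 0)) a 0 \is (gen_shift a).-homog.
Proof.
by case: (gen_entry_homog a 0) => [->|[e -> he]]; [exact: dhomog0 | exact: he].
Qed.

Lemma gen_aug_image p : I p <-> exists v : 'rV[S]_(gen_rank (minimal_gens (syzygy 0))),
  p = (v *m gen_rows (minimal_gens (syzygy 0))) 0 0.
Proof.
have gen := @gen_generates _ (minimal_gens (syzygy 0)).
split=> [Ip|[v ->]]; last first.
  by apply: (gen _).2; exists v.
have /gen [u uE] : @syz_pred (syzygy 0) (const_mx p) by rewrite /= /ideal_row mxE.
by exists u; rewrite -uE mxE.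
Qed.

Lemma gen_exact i (v : 'rV[S]_(gen_rank (minimal_gens (syzygy i)))) :
  v *m gen_rows (minimal_gens (syzygy i)) = 0 <->
  exists w, v = w *m gen_rows (minimal_gens (syzygy i.+1)).
Proof. exact: (@gen_generates _ (minimal_gens (syzygy i.+1)) v). Qed.

Definition canonical_resolution : graded_free_resolution I :=
  @GradedFreeResolution K N I (fun i => gen_rank (minimal_gens (syzygy i)))
    (fun i => @gen_shift _ (minimal_gens (syzygy i)))
    (gen_rows (minimal_gens (syzygy 0)))
    (fun i => gen_rows (minimal_gens (syzygy i.+1)))
    gen_aug_homog (fun i a b => gen_entry_homog a b) gen_aug_image
    (@gen_exact 0) (fun i => @gen_exact i.+1).

Lemma canonical_resolution_minimal : minimal_resolution canonical_resolution.
Proof.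
move=> i a b /=.
have : row a (gen_rows (minimal_gens (syzygy i.+1))) *m gen_rows (minimal_gens (syzygy i)) = 0.
  by apply/gen_exact; exists (delta_mx 0 a); exact: rowE.
by move/(@gen_minimal _ (minimal_gens (syzygy i)))/(_ b); rewrite mxE.
Qed.

End Existence.

(** By [shift_occursP] every minimal resolution has the same shifts, so [has_regularity] holds for
    at most one value; the canonical resolution shows that it holds for [m], and the default of
    [xget] is avoided. *)
Theorem reg_koszul (I : S -> Prop) (m : nat) :
    graded_submodule ideal_grading (ideal_row I) ->
    (forall i e, (m < e)%N -> vanish I i e) ->
    (exists i, ~ vanish I i m) ->
  reg I = m%:Z.
Proof.
move=> gI van nvan.
have regm k : has_regularity I k -> k = m%:Z.
  move=> [F [minF le [i0 [a0 eqk]]]].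
  have [i /(shift_occursP gI minF) [a am]] := nvan.
  have lemk : m%:Z <= k.
    have := le i a; rewrite am PoszD addrK; exact.
  (* A larger value would be a nonnegative integer attained by some shift, hence a nonvanishing
     homology group above [m]. *)
  apply/eqP; rewrite eq_le lemk andbT leNgt; apply/negP => ltk.
  have [e eE] : exists e : nat, k = e%:Z.
    by case: k lemk {le eqk ltk} => // e _; exists e.
  have /(shift_occursP gI minF) : exists a : 'I_(res_rank F i0), res_shift a = (e + i0)%N.
    exists a0; apply/eqP; rewrite -eqz_nat PoszD -eE -eqk subrK //.
  by apply; apply: van; move: ltk; rewrite eE ltz_nat.
have vI : exists n, forall i e, (n <= e)%N -> vanish I i e by exists m.+1.
have minF := @canonical_resolution_minimal I gI vI.
set F := canonical_resolution gI vI in minF.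
have hasm : has_regularity I m%:Z.
  exists F; split=> // [i a|].
    rewrite lerBlDr leNgt; apply/negP => lt.
    have [e eE] : exists e, res_shift a = (e + i)%N.
      exists (res_shift a - i)%N; rewrite subnK //.
      by move: lt; rewrite -PoszD ltz_nat => /ltnW; apply: leq_trans; exact: leq_addl.
    have /(shift_occursP gI minF) : exists a : 'I_(res_rank F i), res_shift a = (e + i)%N.
      by exists a.
    by apply; apply: van; move: lt; rewrite eE -PoszD ltz_nat ltn_add2r.
  have [i /(shift_occursP gI minF) [a am]] := nvan.
  by exists i, a; rewrite am PoszD addrK.
by rewrite /reg; case: xgetP => [k -> /regm //|/(_ m%:Z)].
Qed.

End Regularity.

(** * Koszul homology of quotients by ideals *)

Section IdealOf.
Variables (K : fieldType) (N : nat).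
Local Notation S := {mpoly K[N]}.
Local Notation X := (@variables K N).
Implicit Types (s t : seq S) (p q f g : S) (k : 'I_N).

Definition ideal_of s : S -> Prop := generated_ideal (fun p => p \in s).

Lemma ideal_of0 s : ideal_of s 0.
Proof.
by exists 0%N, (fun=> 0), (fun=> 0); split=> [[]|] //; rewrite big_ord0.
Qed.

Lemma ideal_of_nil p : ideal_of [::] p <-> p = 0.
Proof.
split=> [[k [c [g [gs ->]]]]|->]; last exact: ideal_of0.
by rewrite big1 // => i _; have := gs i.
Qed.

Lemma ideal_of_cons f s p :
  ideal_of (f :: s) p <-> exists a b, ideal_of s a /\ p = a + f * b.
Proof.
split=> [[k [c [g [gs ->]]]]|[_ [b [[k [c [g [gs ->]]]] ->]]]]; last first.
  exists k.+1, (fun i => if unlift ord0 i is Some j then c j else b),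
    (fun i => if unlift ord0 i is Some j then g j else f); split.
    by move=> i; case: unliftP => [j _|_]; rewrite inE ?gs ?eqxx ?orbT.
  rewrite big_ord_recl unlift_none addrC mulrC; congr (_ + _).
  by apply: eq_bigr => i _; rewrite liftK.
elim: k c g gs => [|k IH] c g gs.
  by exists 0, 0; split; [exact: ideal_of0 | rewrite big_ord0 mulr0 addr0].
have [a [b [[n [c' [g' [gs' ->]]]] E]]] := IH (fun i => c (lift ord0 i)) (fun i => g (lift ord0 i)) (fun i => gs _).
rewrite big_ord_recl {}E; have := gs ord0; rewrite inE => /predU1P[->|g0s].
  exists (\sum_i c' i * g' i), (c ord0 + b); split; first by exists n, c', g'.
  by rewrite addrCA mulrDr [f * c _]mulrC.
exists (c ord0 * g ord0 + \sum_i c' i * g' i), b; rewrite addrA; split=> //.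
exists n.+1, (fun i => if unlift ord0 i is Some j then c' j else c ord0),
  (fun i => if unlift ord0 i is Some j then g' j else g ord0); split.
  by move=> i; case: unliftP.
rewrite big_ord_recl unlift_none; congr (_ + _).
by apply: eq_bigr => i _; rewrite liftK.
Qed.

Lemma ideal_ofM s c p : ideal_of s p -> ideal_of s (c * p).
Proof.
move=> [k [d [g [gs ->]]]]; exists k, (fun i => c * d i), g; split=> //.
by rewrite mulr_sumr; apply: eq_bigr => i _; rewrite mulrA.
Qed.

Lemma ideal_ofB s p q : ideal_of s p -> ideal_of s q -> ideal_of s (p - q).
Proof.
elim: s p q => [|f s IH] p q.
  by move=> /ideal_of_nil -> /ideal_of_nil ->; rewrite subrr; exact: ideal_of0.
move=> /ideal_of_cons [a [b [sa ->]]] /ideal_of_cons [a' [b' [sa' ->]]].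
apply/ideal_of_cons; exists (a - a'), (b - b'); split; first exact: IH.
by rewrite mulrBr opprD addrACA.
Qed.

Lemma ideal_ofN s p : ideal_of s p -> ideal_of s (- p).
Proof. by rewrite -mulN1r; exact: ideal_ofM. Qed.

Lemma ideal_ofD s p q : ideal_of s p -> ideal_of s q -> ideal_of s (p + q).
Proof. by move=> sp sq; rewrite -[q]opprK; apply: ideal_ofB => //; exact: ideal_ofN. Qed.

Lemma mem_ideal_of s g : g \in s -> ideal_of s g.
Proof.
move=> gs; exists 1%N, (fun=> 1), (fun=> g); split=> //.
by rewrite big_ord_recl big_ord0 mul1r addr0.
Qed.

Lemma mem_ideal_ofM s g c : g \in s -> ideal_of s (c * g).
Proof. by move=> gs; apply/ideal_ofM/mem_ideal_of. Qed.

Lemma ideal_of_ind s (P : S -> Prop) : P 0 ->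
    (forall p q, P p -> P q -> P (p + q)) -> {in s, forall g c, P (c * g)} ->
  forall p, ideal_of s p -> P p.
Proof.
move=> P0 PD PM p [k [c [g [gs ->]]]]; apply: big_ind => // i _.
exact: (PM _ (gs i)).
Qed.

Lemma ideal_of_sub s t : {in s, forall g, ideal_of t g} ->
  forall p, ideal_of s p -> ideal_of t p.
Proof.
move=> st; apply: ideal_of_ind; [exact: ideal_of0 | exact: ideal_ofD |].
by move=> g gs c; apply/ideal_ofM/st.
Qed.

Definition homogeneous_seq s := {in s, forall g, exists d, g \is d.-homog}.

Lemma ideal_of_graded s : homogeneous_seq s ->
  graded_submodule (row_grading K N (fun=> 0%N) : grading X 'rV[S]_1)
    (ideal_row (ideal_of s)).
Proof.
rewrite /ideal_row => hs; split=> [|e v sv]; last first.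
  rewrite row_gradingE mxE /= subn0; move: (v 0 0) sv.
  apply: ideal_of_ind => [|p q|g gs c].
  - by rewrite raddf0; exact: ideal_of0.
  - by rewrite raddfD; exact: ideal_ofD.
  have [d hg] := hs g gs; rewrite mulrC.
  case: (leqP d e) => [le|lt]; last by rewrite (pihomogM_low _ hg lt); exact: ideal_of0.
  by rewrite -(subnK le) (pihomogM _ _ hg) mulrC; exact: mem_ideal_ofM.
split=> [|p v sv]; last by rewrite mxE; exact: ideal_ofM.
by split=> [|u v su sv]; rewrite !mxE; [exact: ideal_of0 | exact: ideal_ofB].
Qed.

(** With generators free of the variable, the ideal is extended from the smaller polynomial ring:
    splitting the coefficients splits every member inside the ideal. *)
Lemma ideal_of_kill_split k s p : {in s, forall g, kill k g = g} -> ideal_of s p ->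
  [/\ ideal_of s (kill k p) & exists2 q, ideal_of s q & p = kill k p + 'X_k * q].
Proof.
move=> ks; move: p; apply: ideal_of_ind => [|p q [sp [p' sp' pE]] [sq [q' sq' qE]]|g gs c].
- rewrite rmorph0; split; first exact: ideal_of0.
  by exists 0; [exact: ideal_of0 | rewrite mulr0 addr0].
- rewrite rmorphD; split; first exact: ideal_ofD.
  exists (p' + q'); first exact: ideal_ofD.
  by rewrite mulrDr addrACA -pE -qE.
- have [q cE _] := kill_split k c.
  rewrite rmorphM /= (ks g gs); split; first exact: mem_ideal_ofM.
  exists (q * g); first exact: mem_ideal_ofM.
  by rewrite {1}cE mulrDl mulrA.
Qed.

Lemma var_neq0 k : 'X_k != 0 :> S.
Proof.
by apply/eqP => /(congr1 (mcoeff U_(k))); rewrite mcoeffX eqxx mcoeff0 => /eqP; rewrite oner_eq0.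
Qed.

Lemma variable_nonzerodivisor k s p : {in s, forall g, kill k g = g} ->
  ideal_of s ('X_k * p) -> ideal_of s p.
Proof.
move=> ks /(ideal_of_kill_split ks) [_ [q sq]].
rewrite rmorphM /= kill_var eqxx mul0r add0r => /(mulfI (var_neq0 k)) -> //.
Qed.

Definition ideal_vanish s e :=
  koszul_vanish (row_grading K N (fun=> 0%N) : grading X 'rV[S]_1)
    (ideal_row (ideal_of s)) e.

Lemma ideal_row_cons f s v :
  add_multiples (ideal_row (ideal_of s)) f v <-> ideal_row (ideal_of (f :: s)) v.
Proof.
split=> [[a [b [sa ->]]]|/ideal_of_cons [a [b [sa E]]]].
  by apply/ideal_of_cons; exists (a 0 0), (b 0 0); rewrite !mxE.
exists (const_mx a), (const_mx b); rewrite /ideal_row mxE; split=> //.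
by apply/rowP => i; rewrite [i]ord1 !mxE.
Qed.

Lemma ideal_vanish_variable s k e : homogeneous_seq s ->
    {in s, forall g, kill k g = g} ->
  ideal_vanish s e.+1 -> ideal_vanish ('X_k :: s) e.+1.
Proof.
move=> hs ks van; apply: koszul_vanish_ext (ideal_row_cons _ _) _.
have h1 : 'X_k \is 1.-homog := variable_homog (mem_variables K k).
rewrite -[e.+1]addn1.
apply: koszul_vanish_add_multiples (ideal_of_graded hs) _ _ _ _.
- by move=> e' v; exact: (row_projM _ _ _ h1).
- by move=> v; rewrite /ideal_row mxE; exact: variable_nonzerodivisor.
- exact: van.
- by rewrite addn1.
Qed.

Lemma ideal_vanish_variable_quotient s k e :
    (forall p, ideal_of s ('X_k * p) -> ideal_of s p) -> homogeneous_seq s ->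
  ideal_vanish ('X_k :: s) e -> ideal_vanish s e.
Proof.
move=> nzd hs van.
apply: (koszul_vanish_linear_nonzerodivisor (ideal_of_graded hs) (mem_variables K k)).
  by move=> v; rewrite /ideal_row mxE; exact: nzd.
by apply: koszul_vanish_ext van => v; split=> /ideal_row_cons.
Qed.

Lemma quadric_homog k1 k2 k3 k4 : ('X_k1 * 'X_k2 - 'X_k3 * 'X_k4 : S) \is 2.-homog.
Proof.
have h i : ('X_i : S) \is 1.-homog := variable_homog (mem_variables K i).
by rewrite rpredB //; apply: (dhomogM (d := 1%N) (e := 1%N)).
Qed.

Section Quadric.
Variables (s : seq S) (k1 k2 k3 k4 : 'I_N).
Let f : S := 'X_k1 * 'X_k2 - 'X_k3 * 'X_k4.
Hypotheses (hs : homogeneous_seq s) (nzd : forall p, ideal_of s (f * p) -> ideal_of s p).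

Lemma ideal_vanish_quadric e :
  ideal_vanish s e.+1 -> ideal_vanish s e.+2 -> ideal_vanish (f :: s) e.+2.
Proof.
move=> van1 van2; apply: koszul_vanish_ext (ideal_row_cons _ _) _.
have hf := quadric_homog k1 k2 k3 k4; rewrite -[e.+2]addn2.
apply: koszul_vanish_add_multiples (ideal_of_graded hs) _ _ _ _.
- by move=> e' v; exact: (row_projM _ _ _ hf).
- by move=> v; rewrite /ideal_row mxE; exact: nzd.
- exact: van1.
- by rewrite addn2.
Qed.

Lemma ideal_vanish_quadric_quotient e :
  ideal_vanish (f :: s) e.+1 -> ideal_vanish s e.
Proof.
move=> van.
apply: (koszul_vanish_quadric_nonzerodivisor (ideal_of_graded hs)
  (mem_variables K k1) (mem_variables K k3) (mem_variables K k2) (mem_variables K k4)).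
  by move=> v; rewrite /ideal_row mxE; exact: nzd.
by apply: koszul_vanish_ext van => v; split=> /ideal_row_cons.
Qed.

End Quadric.

Lemma ideal_vanish_nil e : ideal_vanish [::] e.+1.
Proof.
apply: (koszul_vanish_ext (J := fun v => v = 0)).
  move=> v; rewrite /ideal_row ideal_of_nil; split=> [->|v0]; first by rewrite mxE.
  by apply/rowP => i; rewrite [i]ord1 v0 mxE.
apply: koszul_vanish0; first exact: rows_regular.
by move=> v gv; apply/combination_variablesP => a; exact: (graded_constant gv).
Qed.

(** The class of 1 survives in H_0(S/I)_0 when every generator has zero constant term. *)
Lemma ideal_nonvanish0 s : {in s, forall g, g@_0 = 0} -> ~ ideal_vanish s 0.
Proof.
move=> s0 van.
have [||w /kin_kbot] := van (kemb X (const_mx 1)).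
- apply: (kin_kemb _ (graded_subgroup _ _)); rewrite /graded row_gradingE.
  by apply/rowP => a; rewrite !mxE subnn; apply: pihomog_dE; exact: dhomog1.
- by rewrite kd_kemb; apply: (subgroup0 (kin_subgroup _ _)); split=> [|u v su sv];
    rewrite /ideal_row !mxE; [exact: ideal_of0 | exact: ideal_ofB].
have s00 p : ideal_of s p -> p@_0 = 0.
  move: p; apply: ideal_of_ind => [|a b a0 b0|g gs c]; first exact: mcoeff0.
    by rewrite mcoeffD a0 b0 addr0.
  by rewrite rmorphM /= (s0 g gs) mulr0.
move=> /s00; rewrite kbotB kbot_kemb !mxE mcoeffB mcoeff1 eqxx.
have /combination_variablesP -> : combination X (fun=> True) (kbot (kd w)).
  by apply: kbot_kd; exact: kin_true.
by rewrite subr0 => /eqP; rewrite oner_eq0.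
Qed.

Section SumIntersection.
Variables (i b c d : seq S).
Hypotheses (hi : homogeneous_seq i) (hb : homogeneous_seq b).
Hypothesis (inter : forall p, ideal_of i p -> ideal_of b p -> ideal_of c p).
Hypotheses (ci : {in c, forall g, ideal_of i g}) (cb : {in c, forall g, ideal_of b g}).
Hypothesis (id : {in i, forall g, ideal_of d g}) (bd : {in b, forall g, ideal_of d g}).
Hypothesis (sum : {in d, forall g, ideal_of i g \/ ideal_of b g}).

Let interE v : intersection (ideal_row (ideal_of i)) (ideal_row (ideal_of b)) v <->
  ideal_row (ideal_of c) v.
Proof.
split=> [[iv bv]|cv]; first exact: inter.
by split; [apply: (ideal_of_sub ci) | apply: (ideal_of_sub cb)].
Qed.

Let sumE v : sum_pred (ideal_row (ideal_of i)) (ideal_row (ideal_of b)) v <->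
  ideal_row (ideal_of d) v.
Proof.
split=> [[u [w [iu bw ->]]]|dv].
  by rewrite /ideal_row mxE; apply: ideal_ofD; [apply: (ideal_of_sub id) | apply: (ideal_of_sub bd)].
have : exists p q, [/\ ideal_of i p, ideal_of b q & v 0 0 = p + q].
  have {}dv : ideal_of d (v 0 0) := dv.
  move: (v 0 0) dv; apply: ideal_of_ind => [|p q [p1 [p2 [? ? ->]]] [q1 [q2 [? ? ->]]]|g gd e].
  - by exists 0, 0; rewrite addr0; split=> //; exact: ideal_of0.
  - by exists (p1 + q1), (p2 + q2); split; rewrite 1?addrACA //; exact: ideal_ofD.
  case: (sum gd) => [ig|bg]; [exists (e * g), 0 | exists 0, (e * g)].
    by rewrite addr0; split=> //; [exact: ideal_ofM | exact: ideal_of0].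
  by rewrite add0r; split=> //; [exact: ideal_of0 | exact: ideal_ofM].
move=> [p [q [ip bq E]]]; exists (const_mx p), (const_mx q).
rewrite /ideal_row !mxE; split=> //.
by apply/rowP => j; rewrite [j]ord1 !mxE.
Qed.

Lemma ideal_vanish_intersection e :
  ideal_vanish i e.+2 -> ideal_vanish b e.+2 -> ideal_vanish d e.+1 ->
  ideal_vanish c e.+2.
Proof.
move=> vi vb vd; apply: koszul_vanish_ext interE _.
apply: koszul_vanish_intersection (ideal_of_graded hi) (ideal_of_graded hb) vi vb _.
by apply: koszul_vanish_ext vd => v; split=> /sumE.
Qed.

Lemma ideal_vanish_summand e :
  ideal_vanish c e.+1 -> ideal_vanish d e.+1 -> ideal_vanish b e.+1.
Proof.
move=> vc vd; apply: (koszul_vanish_summand (ideal_of_graded hi) (ideal_of_graded hb)).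
  by apply: koszul_vanish_ext vc => v; split=> /interE.
by apply: koszul_vanish_ext vd => v; split=> /sumE.
Qed.

End SumIntersection.

(** The quotient has regularity [m.+1] and the ideal one more. A positive degree is required because
    the Koszul homology of S vanishes only there. *)
Lemma reg_ideal_of s m (I : S -> Prop) : homogeneous_seq s ->
    (forall p, I p <-> ideal_of s p) ->
    (forall e, (m.+1 < e)%N -> ideal_vanish s e) -> ~ ideal_vanish s m.+1 ->
  reg I = m.+2%:Z.
Proof.
move=> hs Is van nvan; have gs := ideal_of_graded hs.
have -> : I = ideal_of s by apply/funext => p; apply/propext.
have v0 e : koszul_vanish (row_grading K N (fun=> 0%N) : grading X 'rV[S]_1)
    (fun v => v = 0) e.+1.
  apply: (koszul_vanish_ext (J := ideal_row (ideal_of [::])) _ (@ideal_vanish_nil e)) => v.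
  rewrite /ideal_row ideal_of_nil; split=> [v0|->]; last by rewrite mxE.
  by apply/rowP => i; rewrite [i]ord1 v0 mxE.
apply: reg_koszul => // [i [|[|e]] //|].
  by move=> lt; apply: (koszul_vanish_at_quotient gs (v0 _)); exact: van.
apply: contrapT => none; apply: nvan; apply: (koszul_vanish_quotient gs (v0 _)) => i.
by apply: contrapT => vi; apply: none; exists i.
Qed.

End IdealOf.

(** * Binomial ideals of complete graphs, linear forests and cones *)

Section VertexIdeals.
Variables (K : fieldType) (N : nat) (V : eqType) (xi yi : V -> 'I_N).
Hypotheses (xi_inj : injective xi) (yi_inj : injective yi) (xy : forall i j, xi i != yi j).
Local Notation S := {mpoly K[N]}.
Local Notation x i := ('X_(xi i) : S).
Local Notation y i := ('X_(yi i) : S).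
Local Notation kx i := (@kill K N (xi i)).
Local Notation ky i := (@kill K N (yi i)).
Implicit Types (W : seq V) (p q : S) (a b i j v : V).

Let yx i j : yi j == xi i = false. Proof. by rewrite eq_sym (negbTE (xy i j)). Qed.
Let xy' i j : xi i == yi j = false. Proof. exact: negbTE. Qed.
Let killE := (kill_var, inj_eq xi_inj, inj_eq yi_inj, xy', yx, eqxx).

Definition edge_binomial i j : S := x i * y j - x j * y i.
Local Notation f := edge_binomial.

Lemma edge_binomial_homog i j : f i j \is 2.-homog.
Proof. exact: quadric_homog. Qed.

Lemma edge_binomial_sym i j : f j i = - f i j.
Proof. by rewrite /f opprB. Qed.

(** Both orders and the diagonal, where the binomial is 0, are kept, so no order on the vertices is
    needed. *)
Definition complete_binomials W : seq S := [seq f i j | i <- W, j <- W].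
Definition x_variables W : seq S := [seq x i | i <- W].

Lemma complete_binomials_homog W : homogeneous_seq (complete_binomials W).
Proof.
by move=> g /allpairsP [[i j] /= [_ _ ->]]; exists 2%N; exact: edge_binomial_homog.
Qed.

Lemma variables_homog (s : seq S) : {subset s <= @variables K N} -> homogeneous_seq s.
Proof. by move=> sX g /sX /variable_homog hg; exists 1%N. Qed.

Lemma x_variables_homog W : homogeneous_seq (x_variables W).
Proof. by apply: variables_homog => g /mapP [i _ ->]; exact: mem_variables. Qed.

Lemma homogeneous_cons k (s : seq S) : homogeneous_seq s -> homogeneous_seq ('X_k :: s).
Proof.
move=> hs g; rewrite inE => /predU1P [->|]; last exact: hs.
by exists 1%N; exact: (variable_homog (mem_variables K k)).
Qed.

Lemma kx_complete W a : a \notin W -> {in complete_binomials W, forall g, kx a g = g}.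
Proof.
move=> aW g /allpairsP [[i j] /= [iW jW ->]].
rewrite /f rmorphB !rmorphM /= !killE.
by rewrite !(negbTE (memPn aW _ _)).
Qed.

Lemma ky_complete W a : a \notin W -> {in complete_binomials W, forall g, ky a g = g}.
Proof.
move=> aW g /allpairsP [[i j] /= [iW jW ->]].
rewrite /f rmorphB !rmorphM /= !killE.
by rewrite !(negbTE (memPn aW _ _)).
Qed.

Lemma kx_x_variables W a : a \notin W -> {in x_variables W, forall g, kx a g = g}.
Proof.
by move=> aW g /mapP [i iW ->]; rewrite !killE (negbTE (memPn aW _ iW)).
Qed.

Lemma ky_x_variables W a : {in x_variables W, forall g, ky a g = g}.
Proof. by move=> g /mapP [i iW ->]; rewrite !killE. Qed.

Lemma mem_complete_binomials W i j : i \in W -> j \in W -> f i j \in complete_binomials W.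
Proof. by move=> iW jW; apply: allpairs_f. Qed.

(** Pairs [(sum_i h_i x_i, sum_i h_i y_i)] with [i] ranging over [W]. *)
Fixpoint linear_pair W p q : Prop :=
  if W is a :: W' then
    exists c p' q', [/\ linear_pair W' p' q', p = c * x a + p' & q = c * y a + q']
  else p = 0 /\ q = 0.

Lemma linear_pair0 W : linear_pair W 0 0.
Proof.
by elim: W => [|a W IH] //=; exists 0, 0, 0; rewrite !mul0r addr0.
Qed.

Lemma linear_pairD W p q p' q' :
  linear_pair W p q -> linear_pair W p' q' -> linear_pair W (p + p') (q + q').
Proof.
elim: W p q p' q' => [|a W IH] p q p' q' /=; first by move=> [-> ->] [-> ->]; rewrite addr0.
move=> [c [r [s [L -> ->]]]] [c' [r' [s' [L' -> ->]]]].
exists (c + c'), (r + r'), (s + s'); split; [exact: IH | ring | ring].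
Qed.

Lemma linear_pairM W c p q : linear_pair W p q -> linear_pair W (c * p) (c * q).
Proof.
elim: W p q => [|a W IH] p q /=; first by move=> [-> ->]; rewrite mulr0.
move=> [d [r [s [L -> ->]]]]; exists (c * d), (c * r), (c * s).
by rewrite !mulrDr !mulrA; split=> //; exact: IH.
Qed.

Lemma linear_pairB W p q p' q' :
  linear_pair W p q -> linear_pair W p' q' -> linear_pair W (p - p') (q - q').
Proof.
move=> L L'; rewrite -[- p']mulN1r -[- q']mulN1r.
by apply: linear_pairD => //; exact: linear_pairM.
Qed.

Lemma linear_pair_mem W i : i \in W -> linear_pair W (x i) (y i).
Proof.
elim: W => [|a W IH] //=; rewrite inE => /predU1P [->|/IH L].
  by exists 1, 0, 0; rewrite !mul1r !addr0; split=> //; exact: linear_pair0.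
by exists 0, (x i), (y i); rewrite !mul0r !add0r.
Qed.

(** The combination y_j (x_i, y_i) - y_i (x_j, y_j) equals (f_ij, 0). *)
Lemma linear_pair_complete W p :
  ideal_of (complete_binomials W) p -> linear_pair W p 0.
Proof.
move: p; apply: ideal_of_ind => [|p q Lp Lq|g gW c]; first exact: linear_pair0.
  by rewrite -[0]addr0; exact: linear_pairD.
rewrite -(mulr0 c); apply: linear_pairM.
case/allpairsP: gW => [[i j] /= [iW jW ->]].
have := linear_pairB (linear_pairM (y j) (linear_pair_mem iW))
  (linear_pairM (y i) (linear_pair_mem jW)).
by rewrite [y j * x i]mulrC [y i * x j]mulrC [y j * y i]mulrC subrr.
Qed.

Lemma linear_pair_x W p q : linear_pair W p q -> ideal_of (x_variables W) p.
Proof.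
elim: W p q => [|a W IH] p q /=; first by move=> [-> _]; exact: ideal_of0.
move=> [c [p' [q' [/IH L -> _]]]]; apply/ideal_of_cons.
by exists p', c; rewrite addrC [c * _]mulrC.
Qed.

Lemma x_linear_pair W p : ideal_of (x_variables W) p -> exists q, linear_pair W p q.
Proof.
elim: W p => [|a W IH] p; first by move=> /ideal_of_nil ->; exists 0.
move=> /ideal_of_cons [p' [c [/IH [q' L] ->]]].
by exists (c * y a + q'), c, p', q'; rewrite addrC [c * _]mulrC.
Qed.

Lemma linear_pair_star W a p q : linear_pair W p q ->
  ideal_of [seq f i a | i <- W] (p * y a - q * x a).
Proof.
elim: W p q => [|b W IH] p q /=.
  by move=> [-> ->]; rewrite !mul0r subr0; exact: ideal_of0.
move=> [c [p' [q' [L -> ->]]]]; apply/ideal_of_cons.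
exists (p' * y a - q' * x a), c; split; first exact: IH.
by rewrite /f; ring.
Qed.

Lemma star_linear_pair W a r : ideal_of [seq f i a | i <- W] r ->
  exists p q, linear_pair W p q /\ r = p * y a - q * x a.
Proof.
elim: W r => [|b W IH] r.
  by move=> /ideal_of_nil ->; exists 0, 0; rewrite !mul0r subr0.
move=> /ideal_of_cons [_ [c [/IH [p [q [L ->]]] ->]]].
exists (c * x b + p), (c * y b + q); split; first by exists c, p, q.
by rewrite /f; ring.
Qed.

Lemma star_complete W a : {in [seq f i a | i <- W],
  forall g, ideal_of (complete_binomials (a :: W)) g}.
Proof.
move=> g /mapP [i iW ->]; apply/mem_ideal_of/mem_complete_binomials.
  by rewrite inE iW orbT.
exact: mem_head.
Qed.

Lemma complete_binomials_sub W W' : {subset W <= W'} ->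
  {in complete_binomials W, forall g, ideal_of (complete_binomials W') g}.
Proof.
move=> sW g /allpairsP [[i j] /= [iW jW ->]].
by apply/mem_ideal_of/mem_complete_binomials; exact: sW.
Qed.

Lemma complete_cons_sub W a : {in complete_binomials (a :: W),
  forall g, ideal_of ([seq f i a | i <- W] ++ complete_binomials W) g}.
Proof.
move=> g /allpairsP [[i j] /= []]; rewrite !inE => /predU1P [->|iW] /predU1P [->|jW] ->.
- by rewrite /f subrr; exact: ideal_of0.
- rewrite edge_binomial_sym; apply/ideal_ofN/mem_ideal_of.
  by rewrite mem_cat (map_f (fun i => f i a) jW).
- by apply/mem_ideal_of; rewrite mem_cat (map_f (fun i => f i a) iW).
- by apply/mem_ideal_of; rewrite mem_cat mem_complete_binomials ?orbT.
Qed.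

Lemma ideal_of_cat (s t : seq S) p : ideal_of (s ++ t) p ->
  exists q r, [/\ ideal_of s q, ideal_of t r & p = q + r].
Proof.
elim: s p => [|g s IH] p /=.
  by move=> tp; exists 0, p; rewrite add0r; split=> //; exact: ideal_of0.
move=> /ideal_of_cons [_ [c [/IH [q [r [sq tr ->]]] ->]]].
exists (q + g * c), r; rewrite addrAC; split=> //.
by apply/ideal_of_cons; exists q, c.
Qed.

Lemma complete_consP W a r : ideal_of (complete_binomials (a :: W)) r ->
  exists (j : S) p q, [/\ ideal_of (complete_binomials W) j, linear_pair W p q &
    r = j + (p * y a - q * x a)].
Proof.
move/(ideal_of_sub (@complete_cons_sub W a))/ideal_of_cat.
move=> [_ [j [/star_linear_pair [p [q [L ->]]] Wj ->]]].
by exists j, p, q; rewrite addrC.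
Qed.

Lemma linear_pair_complete_cons W a p q : linear_pair W p q ->
  ideal_of (complete_binomials (a :: W)) (p * y a - q * x a).
Proof. by move/(linear_pair_star a); apply: ideal_of_sub; exact: star_complete. Qed.

(* A syzygy of the x_i is a Koszul syzygy, hence is killed modulo the 2-minors
   when the x_i are replaced by the y_i. *)
Lemma linear_pair_syzygy W q : uniq W -> linear_pair W 0 q ->
  ideal_of (complete_binomials W) q.
Proof.
elim: W q => [|a W IH] q /=; first by move=> _ [_ ->]; exact: ideal_of0.
move=> /andP [aW uW] [c [p' [q' [L E ->]]]].
have [c' Lc] : exists c', linear_pair W c c'.
  apply: x_linear_pair; apply: (variable_nonzerodivisor (kx_x_variables aW)).
  rewrite mulrC; have -> : c * x a = - p' by apply/eqP; rewrite -addr_eq0 -E.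
  by apply: ideal_ofN; exact: linear_pair_x L.
(* Since [c] is a combination of the x_i over W, the relation becomes one over W alone; the error
   [c * y a - c' * x a] is a combination of binomials through [a]. *)
have := linear_pairD (linear_pairM (x a) Lc) L.
rewrite [x a * c]mulrC -E => /(IH _ uW) Wq.
have -> : c * y a + q' = (c * y a - c' * x a) + (x a * c' + q') by ring.
apply: ideal_ofD; first exact: linear_pair_complete_cons.
apply: ideal_of_sub Wq; apply: complete_binomials_sub => i iW.
by rewrite inE iW orbT.
Qed.

(** Subtracting the pair (p, 0) leaves (0, q), a syzygy of the x_i. *)
Lemma linear_pair_transfer W p q : uniq W -> linear_pair W p q ->
  ideal_of (complete_binomials W) p -> ideal_of (complete_binomials W) q.
Proof.
move=> uW L /linear_pair_complete /(linear_pairB L).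
by rewrite subrr subr0; exact: linear_pair_syzygy.
Qed.

Lemma linear_pair_split W a p q : a \notin W -> linear_pair W p q ->
  exists p1 q1, [/\ linear_pair W (kx a p) (kx a q), linear_pair W p1 q1,
    p = kx a p + x a * p1 & q = kx a q + x a * q1].
Proof.
elim: W p q => [|b W IH] p q /=.
  move=> _ [-> ->]; exists 0, 0; rewrite !rmorph0 mulr0 addr0.
  by split.
rewrite inE negb_or => /andP [ab aW] [c [p' [q' [L pE qE]]]].
have [p1 [q1 [L0 L1 p'E q'E]]] := IH _ _ aW L.
have [d cE _] := kill_split (xi a) c.
have ba : b == a = false by rewrite eq_sym (negbTE ab).
exists (d * x b + p1), (d * y b + q1); rewrite pE qE !rmorphD !rmorphM /= !killE ba.
split.
- by exists (kx a c), (kx a p'), (kx a q').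
- by exists d, p1, q1.
- by rewrite {1}cE {1}p'E; ring.
- by rewrite {1}cE {1}q'E; ring.
Qed.

(** Stands in for primality of the ideal of 2-minors. A member is j + p y_a - q x_a with j in J_W;
    the parts of p and q divisible by x_a can be absorbed, and the parts free of x_a turn out to lie
    in J_W. *)
Lemma complete_nonzerodivisor W a g : uniq (a :: W) ->
  ideal_of (complete_binomials (a :: W)) (x a * g) ->
  ideal_of (complete_binomials (a :: W)) g.
Proof.
move=> /= /andP [aW uW] /complete_consP [j [p [q [Wj L E]]]].
have [p1 [q1 [L0 L1 pE qE]]] := linear_pair_split aW L.
have kW := kx_complete aW; have [Wkj _] := ideal_of_kill_split kW Wj.
pose h := g + q - p1 * y a.
have hE : x a * h = j + kx a p * y a.
  by rewrite /h mulrBr mulrDr E {1}pE; ring.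
have k0 : kx a j + kx a p * y a = 0.
  by have := congr1 (kx a) hE; rewrite rmorphD !rmorphM /= !killE mul0r kill_idem.
(* Setting x_a = 0 puts y_a times this remainder in J_W, whose generators do not involve y_a;
   [linear_pair_transfer] then handles the remainder of [q]. *)
have Wp0 : ideal_of (complete_binomials W) (kx a p).
  apply: (variable_nonzerodivisor (ky_complete aW)); rewrite mulrC.
  have -> : kx a p * y a = - kx a j by apply/eqP; rewrite -addr_eq0 addrC k0.
  exact: ideal_ofN.
have Wq0 := linear_pair_transfer uW L0 Wp0.
have Wh : ideal_of (complete_binomials W) h.
  apply: (variable_nonzerodivisor kW); rewrite hE.
  by apply: ideal_ofD => //; rewrite mulrC; exact: ideal_ofM.
have -> : g = h - kx a q + (p1 * y a - q1 * x a) by rewrite /h {1}qE; ring.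
apply: ideal_ofD; last exact: linear_pair_complete_cons.
have WaW := ideal_of_sub (complete_binomials_sub (W := W) (W' := a :: W) _).
by apply: WaW => [i iW|]; [rewrite inE iW orbT | exact: ideal_ofB].
Qed.

Lemma ideal_vanish_variables (ks : seq 'I_N) e : uniq ks ->
  ideal_vanish [seq ('X_k : S) | k <- ks] e.+1.
Proof.
elim: ks => [|k ks IH] /=; first by move=> _; exact: ideal_vanish_nil.
move=> /andP [kks /IH van]; apply: ideal_vanish_variable van.
  by apply: variables_homog => g /mapP [i _ ->]; exact: mem_variables.
move=> g /mapP [i iks ->]; rewrite kill_var.
by case: eqVneq => // E; rewrite -E iks in kks.
Qed.

Lemma x_variables_map W : x_variables W = [seq 'X_k | k <- [seq xi i | i <- W]].
Proof. by rewrite -map_comp. Qed.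

Lemma ideal_vanish_x_variables W e : uniq W -> ideal_vanish (x_variables W) e.+1.
Proof. by move=> uW; rewrite x_variables_map; apply: ideal_vanish_variables; rewrite map_inj_uniq. Qed.

Lemma complete_x_variables W : {in complete_binomials W,
  forall g, ideal_of (x_variables W) g}.
Proof.
move=> g /allpairsP [[i j] /= [iW jW ->]]; rewrite /f.
by apply: ideal_ofB; rewrite mulrC; apply/mem_ideal_ofM/map_f.
Qed.

Lemma ideal_vanish_add_vertex (s : seq S) a e : homogeneous_seq s ->
    {in s, forall g, kx a g = g} -> {in s, forall g, ky a g = g} ->
  ideal_vanish s e.+1 -> ideal_vanish (x a :: y a :: s) e.+1.
Proof.
move=> hs kxs kys van; apply: ideal_vanish_variable.
- exact: homogeneous_cons.
- by move=> g; rewrite inE => /predU1P [->|/kxs //]; rewrite !killE.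
- exact: ideal_vanish_variable.
Qed.

(* With [J_W] the ideal of the complete graph, [J_(a, W) + (x_a)] is the
   intersection of [(x_a, x_W)] and [(x_a, y_a) + J_W]. *)
Lemma ideal_vanish_complete W e : uniq W -> ideal_vanish (complete_binomials W) e.+2.
Proof.
elim: W => [|a W IH] uaW; first exact: ideal_vanish_nil.
have /andP [aW uW] := uaW.
have sW : {subset W <= a :: W} by move=> i iW; rewrite inE iW orbT.
apply: (ideal_vanish_variable_quotient (k := xi a)).
- by move=> p; exact: complete_nonzerodivisor.
- exact: complete_binomials_homog.
apply: (@ideal_vanish_intersection _ _ (x a :: x_variables W)
  (x a :: y a :: complete_binomials W) _ (y a :: x a :: x_variables W)).
- exact/homogeneous_cons/x_variables_homog.
- exact/homogeneous_cons/homogeneous_cons/complete_binomials_homog.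
- move=> p Pp /ideal_of_cons [_ [c [/ideal_of_cons [j0 [b [Wj ->]]] pE]]].
  have memx : ideal_of (x a :: x_variables W) (x a) by apply/mem_ideal_of/mem_head.
  have Wb : ideal_of (x a :: x_variables W) b.
    apply: (variable_nonzerodivisor (k := yi a)).
      by apply: (@ky_x_variables (a :: W) a).
    have -> : y a * b = p - x a * c - j0 by rewrite pE; ring.
    apply: ideal_ofB; first by apply: ideal_ofB => //; rewrite mulrC; exact: ideal_ofM.
    apply: (ideal_of_sub _ (ideal_of_sub (@complete_x_variables W) Wj)) => g gW.
    by apply: mem_ideal_of; rewrite inE gW orbT.
  move: Wb => /ideal_of_cons [b0 [d [/x_linear_pair [b' L] bE]]].
  (* The partner [b'] of [b0] makes [b0 * y a] congruent to [b' * x a] modulo J_(a, W), so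
     everything outside that ideal is a multiple of [x a]. *)
  apply/ideal_of_cons; exists (j0 + (b0 * y a - b' * x a)), (y a * d + b' + c).
  split; last by rewrite pE bE; ring.
  apply: ideal_ofD; last exact: linear_pair_complete_cons.
  by apply: ideal_of_sub Wj; exact: complete_binomials_sub.
- move=> g; rewrite inE => /predU1P [->|gW]; first exact/mem_ideal_of/mem_head.
  exact: (@complete_x_variables (a :: W)).
- move=> g; rewrite inE => /predU1P [->|]; first exact/mem_ideal_of/mem_head.
  have memx : ideal_of (x a :: y a :: complete_binomials W) (x a) by apply/mem_ideal_of/mem_head.
  have memy : ideal_of (x a :: y a :: complete_binomials W) (y a).
    by apply/mem_ideal_of; rewrite !inE eqxx orbT.
  move/complete_cons_sub; apply: ideal_of_sub => h; rewrite mem_cat => /orP [/mapP [i iW ->]|hW].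
    by rewrite /f [x a * _]mulrC; apply: ideal_ofB; exact: ideal_ofM.
  by apply/mem_ideal_of; rewrite !inE hW !orbT.
- by move=> g gW; apply/mem_ideal_of; rewrite inE gW orbT.
- move=> g; rewrite !inE => /predU1P [->|/predU1P [->|gW]].
  + by apply/mem_ideal_of; rewrite !inE eqxx orbT.
  + exact/mem_ideal_of/mem_head.
  apply: (ideal_of_sub _ (complete_x_variables gW)) => h hW.
  by apply: mem_ideal_of; rewrite !inE hW !orbT.
- move=> g; rewrite !inE => /predU1P [->|/predU1P [->|gW]].
  + by right; apply/mem_ideal_of; rewrite !inE eqxx orbT.
  + by left; exact/mem_ideal_of/mem_head.
  by left; apply/mem_ideal_of; rewrite inE gW orbT.
- exact: (@ideal_vanish_x_variables (a :: W)).
- apply: ideal_vanish_add_vertex; [exact: complete_binomials_homog | exact: kx_complete | exact: ky_complete | exact: IH].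
- apply: ideal_vanish_variable; [exact: (@x_variables_homog (a :: W)) | exact: (@ky_x_variables (a :: W)) |].
  exact: (@ideal_vanish_x_variables (a :: W)).
Qed.

(** * Linear forests as complete intersections of quadrics *)

Section LinearForest.
Variable adj : rel V.

(** Only consecutive entries are tested for adjacency, so listing disjoint paths one after another,
    each in order, yields exactly their edges. The head is always an endpoint of the forest, or
    isolated. *)
Fixpoint forest_binomials (U : seq V) : seq S :=
  if U is b :: U' then
    if U' is a :: _ then
      if adj a b then f a b :: forest_binomials U' else forest_binomials U'
    else [::]
  else [::].

Lemma forest_complete U : {subset forest_binomials U <= complete_binomials U}.
Proof.
have mono b W : {subset complete_binomials W <= complete_binomials (b :: W)}.
  move=> g /allpairsP [[i j] /= [iW jW ->]].
  by apply: mem_complete_binomials; rewrite inE ?iW ?jW orbT.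
elim: U => [|b [|a U] IH] //; rewrite -/(forest_binomials (a :: U)) => g.
rewrite [forest_binomials _]/=; case: ifP => _; last by move/IH; exact: mono.
rewrite inE => /predU1P [->|/IH]; last exact: mono.
by apply: mem_complete_binomials; rewrite !inE eqxx ?orbT.
Qed.

Lemma forest_homog U : homogeneous_seq (forest_binomials U).
Proof. by move=> g /forest_complete; exact: complete_binomials_homog. Qed.

Lemma kx_forest U a : a \notin U -> {in forest_binomials U, forall g, kx a g = g}.
Proof. by move=> aU g /forest_complete; exact: kx_complete. Qed.

Lemma ky_forest U a : a \notin U -> {in forest_binomials U, forall g, ky a g = g}.
Proof. by move=> aU g /forest_complete; exact: ky_complete. Qed.

(* Setting [y_b = 0] turns [f a b] into [- x_b y_a]; this gives the part of [p]
   without [y_b], and the rest has a factor [y_b] that can be removed. *)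
Lemma edge_nonzerodivisor (s : seq S) a b p : a != b ->
    {in s, forall g, kx b g = g} -> {in s, forall g, ky b g = g} ->
    (forall p, ideal_of s (y a * p) -> ideal_of s p) ->
  ideal_of s (f a b * p) -> ideal_of s p.
Proof.
move=> ab kxs kys nzd; move: {-1}(msize p) (leqnn (msize p)) => n.
elim: n p => [|n IH] p.
  rewrite leqn0 mmeasure_poly_eq0 => /eqP -> _; exact: ideal_of0.
move=> szp sfp; have [p1 pE szp1] := kill_split (yi b) p.
have [skp _] := ideal_of_kill_split kys sfp.
have sp0 : ideal_of s (ky b p).
  apply: nzd; apply: (variable_nonzerodivisor (k := xi b) kxs).
  have -> : x b * (y a * ky b p) = - ky b (f a b * p).
    by rewrite /f rmorphM rmorphB !rmorphM /= !killE (negbTE ab); ring.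
  exact: ideal_ofN.
rewrite pE; apply: ideal_ofD => //; apply: ideal_ofM; apply: IH.
  by rewrite -ltnS; apply: leq_ltn_trans szp1 _; rewrite ltnS -subn1 leq_subLR add1n.
apply: (variable_nonzerodivisor (k := yi b) kys).
have -> : y b * (f a b * p1) = f a b * p - f a b * ky b p by rewrite {1}pE; ring.
by apply: ideal_ofB => //; exact: ideal_ofM.
Qed.

(** If the head [a] is joined to the next vertex [b], setting y_a = 0 turns the new edge binomial
    into - x_a y_b. Here x_a is a free variable and y_b is cancelled by induction, so the part of
    the cofactor without y_a lies in the smaller ideal. *)
Lemma endpoint_nonzerodivisor a U p : uniq (a :: U) ->
  ideal_of (forest_binomials (a :: U)) (y a * p) ->
  ideal_of (forest_binomials (a :: U)) p.
Proof.
elim: U a p => [|b U IH] a p.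
  by move=> _; exact: (@variable_nonzerodivisor _ _ _ [::]).
move=> uabU; have [aU ubU] : a \notin b :: U /\ uniq (b :: U) by apply/andP.
have kxs := kx_forest aU; have kys := ky_forest aU.
rewrite [forest_binomials _]/= -/(forest_binomials (b :: U)).
case: ifP => _; last exact: variable_nonzerodivisor.
move=> /ideal_of_cons [j0 [h [sj E]]].
have ba : b != a by move: aU; rewrite inE negb_or eq_sym => /andP [].
have nzd q := IH b q ubU.
have skh : ideal_of (forest_binomials (b :: U)) (ky a h).
  apply: nzd; apply: (variable_nonzerodivisor (k := xi a) kxs).
  have -> : x a * (y b * ky a h) = ky a j0.
    have := congr1 (ky a) E; rewrite rmorphM rmorphD rmorphM rmorphB !rmorphM /= !killE.
    by rewrite (negbTE ba) mul0r => E0; rewrite -[RHS]subr0 E0; ring.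
  by have [] := ideal_of_kill_split kys sj.
have [h1 hE _] := kill_split (yi a) h.
apply/ideal_of_cons; exists (p - f b a * h1), h1; split; last by ring.
apply: (variable_nonzerodivisor (k := yi a) kys).
have -> : y a * (p - f b a * h1) = j0 + f b a * ky a h by rewrite mulrBr E {1}hE; ring.
by apply: ideal_ofD => //; exact: ideal_ofM.
Qed.

Lemma forest_edge_nonzerodivisor a b U p : uniq (b :: a :: U) ->
  ideal_of (forest_binomials (a :: U)) (f a b * p) ->
  ideal_of (forest_binomials (a :: U)) p.
Proof.
move=> ubaU; have [baU uaU] : b \notin a :: U /\ uniq (a :: U) by apply/andP.
apply: edge_nonzerodivisor.
- by move: baU; rewrite inE negb_or eq_sym => /andP [].
- exact: kx_forest.
- exact: ky_forest.
- by move=> q; exact: endpoint_nonzerodivisor.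
Qed.

Lemma ideal_vanish_forest U e : uniq U ->
  (size (forest_binomials U) < e)%N -> ideal_vanish (forest_binomials U) e.
Proof.
elim: U e => [|b [|a U] IH] e uU; try by case: e => // e _; exact: ideal_vanish_nil.
have /andP [_ uaU] := uU.
have nzd := fun p => @forest_edge_nonzerodivisor a b U p uU.
have hs := @forest_homog (a :: U).
rewrite [forest_binomials _]/= -/(forest_binomials (a :: U)).
case: ifP => _ /=; last exact: IH.
case: e => [|[|e]] // lt.
by apply: (ideal_vanish_quadric hs nzd); apply: IH => //; apply: ltnW.
Qed.

Lemma ideal_nonvanish_forest U : uniq U ->
  ~ ideal_vanish (forest_binomials U) (size (forest_binomials U)).
Proof.
elim: U => [|b [|a U] IH] uU; try exact: ideal_nonvanish0.
have /andP [_ uaU] := uU.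
have nzd := fun p => @forest_edge_nonzerodivisor a b U p uU.
have hs := @forest_homog (a :: U).
rewrite [forest_binomials _]/= -/(forest_binomials (a :: U)).
case: ifP => _ /=; last exact: IH.
by move/(ideal_vanish_quadric_quotient hs nzd); exact: IH.
Qed.

(** * The cone over a linear forest *)

Section Cone.
Variables (v : V) (W : seq V).
Hypothesis uvW : uniq (v :: W).

Definition cone_binomials : seq S := [seq f i v | i <- W] ++ forest_binomials W.

Lemma cone_binomials_homog : homogeneous_seq cone_binomials.
Proof.
move=> g; rewrite mem_cat => /orP [/mapP [i _ ->]|]; last exact: forest_homog.
by exists 2%N; exact: edge_binomial_homog.
Qed.

Let vW : v \notin W. Proof. by case/andP: uvW. Qed.
Let uW : uniq W. Proof. by case/andP: uvW. Qed.
Let star p : ideal_of [seq f i v | i <- W] p -> ideal_of cone_binomials p.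
Proof.
by apply: ideal_of_sub => g gW; apply/mem_ideal_of; rewrite mem_cat gW.
Qed.
Let forest p : ideal_of (forest_binomials W) p -> ideal_of cone_binomials p.
Proof.
by apply: ideal_of_sub => g gW; apply/mem_ideal_of; rewrite mem_cat gW orbT.
Qed.

(** The relation x_v f_ij = x_j f_iv - x_i f_jv, a 3 by 3 determinant with a repeated row, puts x_v
    J_W in the ideal of the star at v; the analogue for y_v follows. *)
Let x_complete q : ideal_of (complete_binomials W) q -> ideal_of cone_binomials (x v * q).
Proof.
move: q; apply: ideal_of_ind => [|p q p1 q1|g /allpairsP [[i j] /= [iW jW ->]] c].
- by rewrite mulr0; exact: ideal_of0.
- by rewrite mulrDr; exact: ideal_ofD.
have -> : x v * (c * f i j) = (c * x j) * f i v - (c * x i) * f j v by rewrite /f; ring.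
apply: star; apply: ideal_ofB; apply/mem_ideal_ofM.
  exact: (map_f (fun i => f i v) iW).
exact: (map_f (fun i => f i v) jW).
Qed.

Let y_complete q : ideal_of (complete_binomials W) q -> ideal_of cone_binomials (y v * q).
Proof.
move: q; apply: ideal_of_ind => [|p q p1 q1|g /allpairsP [[i j] /= [iW jW ->]] c].
- by rewrite mulr0; exact: ideal_of0.
- by rewrite mulrDr; exact: ideal_ofD.
have -> : y v * (c * f i j) = (c * y j) * f i v - (c * y i) * f j v by rewrite /f; ring.
apply: star; apply: ideal_ofB; apply/mem_ideal_ofM.
  exact: (map_f (fun i => f i v) iW).
exact: (map_f (fun i => f i v) jW).
Qed.

Let base := x v :: y v :: forest_binomials W.

Let star_base p q : linear_pair W p q -> ideal_of base (p * y v - q * x v).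
Proof.
move=> _; apply: ideal_ofB; apply: mem_ideal_ofM; rewrite /base !inE eqxx //.
by rewrite orbT.
Qed.

(** Modulo the star at v the element may be taken in J_W. Its parts divisible by x_v or y_v lie in
    the cone ideal, and setting both variables to 0 in the membership in [base] leaves an element of
    J_H. *)
Lemma cone_intersection p : ideal_of (complete_binomials (v :: W)) p ->
  ideal_of base p -> ideal_of cone_binomials p.
Proof.
move=> /complete_consP [j [r [q [Wj L ->]]]] Bp.
have {Bp} Bj : ideal_of base j.
  by rewrite -[j](addrK (r * y v - q * x v)); apply: ideal_ofB => //; exact: star_base.
apply: ideal_ofD; last exact/star/linear_pair_star.
have [Wj1 [j1 Wj1' jE]] := ideal_of_kill_split (kx_complete vW) Wj.
have [_ [j2 Wj2 jE2]] := ideal_of_kill_split (ky_complete vW) Wj1.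
rewrite jE; apply: ideal_ofD; last exact: x_complete.
rewrite jE2; apply: ideal_ofD; last exact: y_complete.
apply: forest; move: Bj => /ideal_of_cons [_ [c [/ideal_of_cons [h [d [Fh ->]]] ->]]].
rewrite !rmorphD !rmorphM /= !killE rmorph0 !mul0r !addr0.
have [Fh1 _] := ideal_of_kill_split (kx_forest vW) Fh.
by have [] := ideal_of_kill_split (ky_forest vW) Fh1.
Qed.

Let total := x v :: y v :: complete_binomials W.

Let base_homog : homogeneous_seq base.
Proof. exact/homogeneous_cons/homogeneous_cons/forest_homog. Qed.

Let cone_complete : {in cone_binomials, forall g, ideal_of (complete_binomials (v :: W)) g}.
Proof.
move=> g; rewrite mem_cat => /orP [|/forest_complete]; first exact: star_complete.
by apply: complete_binomials_sub => i iW; rewrite inE iW orbT.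
Qed.

Let cone_base : {in cone_binomials, forall g, ideal_of base g}.
Proof.
move=> g; rewrite mem_cat => /orP [/mapP [i iW ->]|gF].
  by have := star_base (linear_pair_mem iW); rewrite /f [x v * _]mulrC.
by apply/mem_ideal_of; rewrite !inE gF !orbT.
Qed.

Let complete_total : {in complete_binomials (v :: W), forall g, ideal_of total g}.
Proof.
move=> g /complete_cons_sub; apply: ideal_of_sub => h.
rewrite mem_cat => /orP [/mapP [i iW ->]|hW].
  by apply: ideal_ofB; [|rewrite mulrC]; apply: mem_ideal_ofM; rewrite !inE eqxx ?orbT.
by apply/mem_ideal_of; rewrite !inE hW !orbT.
Qed.

Let base_total : {in base, forall g, ideal_of total g}.
Proof.
move=> g gB; apply: mem_ideal_of; move: gB; rewrite !inE => /predU1P [->|/predU1P [->|/forest_complete gW]].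
- by rewrite eqxx.
- by rewrite eqxx orbT.
- by rewrite gW !orbT.
Qed.

Let total_sum : {in total, forall g,
  ideal_of (complete_binomials (v :: W)) g \/ ideal_of base g}.
Proof.
move=> g; rewrite !inE => /predU1P [->|/predU1P [->|gW]].
- by right; apply: mem_ideal_of; rewrite !inE eqxx.
- by right; apply: mem_ideal_of; rewrite !inE eqxx orbT.
- by left; apply: complete_binomials_sub gW => i iW; rewrite inE iW orbT.
Qed.

Let vanish_total e : ideal_vanish total e.+2.
Proof.
apply: ideal_vanish_add_vertex; [exact: complete_binomials_homog | exact: kx_complete | exact: ky_complete |].
exact: ideal_vanish_complete.
Qed.

(** The bound 3 comes from Mayer-Vietoris: the sum vanishes from degree 2 on and is used one degree
    lower. *)
Lemma ideal_vanish_cone e : (size (forest_binomials W) < e.+3)%N ->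
  ideal_vanish cone_binomials e.+3.
Proof.
move=> lt; apply: (ideal_vanish_intersection (@complete_binomials_homog (v :: W)) base_homog
  cone_intersection cone_complete cone_base complete_total base_total total_sum).
- exact: ideal_vanish_complete.
- apply: ideal_vanish_add_vertex; [exact: forest_homog | exact: kx_forest | exact: ky_forest |].
  exact: ideal_vanish_forest.
- exact: vanish_total.
Qed.

(** With at least two edges, the sum ideal vanishes in this degree, so vanishing for the cone would
    pass to [base], and then to the forest after removing x_v and y_v. *)
Lemma ideal_nonvanish_cone : (1 < size (forest_binomials W))%N ->
  ~ ideal_vanish cone_binomials (size (forest_binomials W)).
Proof.
move=> gt1; have := ideal_nonvanish_forest uW.
case: (size (forest_binomials W)) gt1 => [|[|m]] // _ nvan van; apply: nvan.
apply: (ideal_vanish_variable_quotient (k := yi v)).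
- by move=> p; apply: variable_nonzerodivisor; exact: ky_forest.
- exact: forest_homog.
apply: (ideal_vanish_variable_quotient (k := xi v)).
- move=> p; apply: variable_nonzerodivisor => g; rewrite inE => /predU1P [->|].
    by rewrite !killE.
  exact: kx_forest.
- exact/homogeneous_cons/forest_homog.
exact: (ideal_vanish_summand (@complete_binomials_homog (v :: W)) base_homog
  cone_intersection cone_complete cone_base complete_total base_total total_sum van (@vanish_total _)).
Qed.

Lemma reg_cone (I : S -> Prop) : (1 < size (forest_binomials W))%N ->
  (forall p, I p <-> ideal_of cone_binomials p) ->
  reg I = (size (forest_binomials W)).+1%:Z.
Proof.
move=> gt1 IE; have := ideal_nonvanish_cone gt1; have := @ideal_vanish_cone.
case: (size (forest_binomials W)) gt1 => [|[|m]] // _ van nvan.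
apply: (reg_ideal_of cone_binomials_homog IE) => // -[|[|[|e]]] // lt.
exact: van.
Qed.

End Cone.
End LinearForest.
End VertexIdeals.

(** * Cones over disjoint paths *)

Section ConeGraph.
Local Open Scope nat_scope.
Variables (q : nat) (t : nat -> nat).
Local Notation G := (cone_over_paths q t).
Implicit Types (a b : G) (i : 'I_q).

Definition apex : G := inl ord0.
Definition path_vertex (i : 'I_q) (j : 'I_(t i)) : G :=
  inr (Tagged (fun i : 'I_q => 'I_(t i)) j).

Lemma apexE (i : 'I_1) : inl i = apex.
Proof. by rewrite [i]ord1. Qed.

Lemma path_vertex_inj i : injective (@path_vertex i).
Proof. by move=> j k [] /eqP; rewrite -tag_eqE /tag_eq eqxx tagged_asE => /eqP. Qed.

Lemma edge_apex a : edge apex a = (a != apex).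
Proof.
by case: a => [i|a] //; rewrite apexE eqxx edge_irr.
Qed.

Lemma edge_path_vertex i (j k : 'I_(t i)) :
  edge (path_vertex j) (path_vertex k) = (j.+1 == k) || (k.+1 == j).
Proof. by rewrite /= /disjoint_union_edge /= eqxx tagged_asE. Qed.

Lemma edge_path_vertexP i i' (j : 'I_(t i)) (k : 'I_(t i')) :
  edge (path_vertex j) (path_vertex k) -> i = i' /\ ((j.+1 == k) || (k.+1 == j)).
Proof.
rewrite /= /disjoint_union_edge /=; case: eqP => //= E; split=> //.
by case: _ / E k H => k; rewrite tagged_asE.
Qed.

Lemma cone_connected : connected_graph G.
Proof.
split; first by apply/card_gt0P; exists apex.
have conn a : connect (@edge G) apex a.
  by case: (eqVneq a apex) => [->|na]; [exact: connect0 | rewrite connect1 // edge_apex].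
have sym : connect_sym (@edge G) by apply: sym_connect_sym; exact: edge_sym.
by move=> a b; apply: connect_trans (conn b); rewrite sym.
Qed.

Definition component (i : 'I_q) : seq G := [seq path_vertex j | j <- enum 'I_(t i)].
Definition path_vertices : seq G := flatten [seq component i | i <- enum 'I_q].

Lemma mem_component i i' (j : 'I_(t i)) : (path_vertex j \in component i') = (i == i').
Proof.
apply/mapP/eqP => [[k _ [E _]] //|<-].
by exists j; rewrite ?mem_enum.
Qed.

Lemma componentP i a : a \in component i -> exists j : 'I_(t i), a = path_vertex j.
Proof. by case/mapP => j _ ->; exists j. Qed.

Lemma mem_path_vertices a : (a \in path_vertices) = (a != apex).
Proof.
apply/flatten_mapP/idP => [[i _ /componentP [j ->]] //|].
case: a => [i|[i j] _]; first by rewrite apexE eqxx.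
by exists i; rewrite ?mem_enum // (mem_component i j).
Qed.

Lemma uniq_component i : uniq (component i).
Proof. by rewrite map_inj_uniq ?enum_uniq //; exact: path_vertex_inj. Qed.

Lemma uniq_path_vertices : uniq path_vertices.
Proof.
rewrite /path_vertices; elim: (enum 'I_q) (enum_uniq 'I_q) => //= i s IH /andP [is_ us].
rewrite cat_uniq uniq_component IH // andbT; apply/hasPn => a /flatten_mapP [i' i's].
case/componentP => j ->; rewrite (mem_component i j).
by apply: contraNneq is_ => <-.
Qed.

Lemma uniq_vertices : uniq (apex :: path_vertices).
Proof. by rewrite /= mem_path_vertices eqxx uniq_path_vertices. Qed.

Lemma mem_vertices a : a \in apex :: path_vertices.
Proof. by rewrite inE mem_path_vertices orbN. Qed.

Lemma index_path_vertices i : exists c, forall j : 'I_(t i),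
  index (path_vertex j) path_vertices = c + j.
Proof.
rewrite /path_vertices; have : i \in enum 'I_q by rewrite mem_enum.
elim: (enum 'I_q) => //= i' s IH; case: (eqVneq i i') => [<- _|ii'].
  exists 0 => j; rewrite index_cat (mem_component i j) eqxx.
  by rewrite index_map ?index_enum_ord //; exact: path_vertex_inj.
rewrite inE (negbTE ii') => /IH [c cE]; exists (size (component i') + c) => j.
by rewrite index_cat (mem_component i' j) (negbTE ii') cE addnA.
Qed.

Lemma edge_index a b : a != apex -> b != apex -> edge a b ->
  index a path_vertices = (index b path_vertices).+1 \/
  index b path_vertices = (index a path_vertices).+1.
Proof.
case: a => [i|[i j]]; first by rewrite apexE eqxx.
case: b => [i'|[i' k]]; first by rewrite apexE eqxx.
move=> _ _ /(@edge_path_vertexP i i' j k) [E]; case: _ / E k => k jk.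
have [c cE] := index_path_vertices i.
rewrite (cE j : index (inr _) _ = _) (cE k : index (inr _) _ = _).
by case/orP: jk => /eqP <-; rewrite addnS; [right | left].
Qed.

(** The apex gets the smallest label and the paths are numbered consecutively. An edge between
    non-consecutive labels must then start at the apex, which is adjacent to everything. *)
Lemma cone_weakly_closed : weakly_closed G.
Proof.
have size_vertices : #|G| = size (apex :: path_vertices).
  by rewrite -(card_uniqP uniq_vertices); apply: eq_card => a; rewrite mem_vertices.
pose label (i : 'I_#|G|) := nth apex (apex :: path_vertices) i.
exists label.
  apply: inj_card_bij; last by rewrite card_ord.
  move=> i j /eqP; rewrite nth_uniq -?size_vertices ?uniq_vertices //.
  by move/eqP/val_inj.
have label_pos (k : 'I_#|G|) : 0 < k ->
    label k != apex /\ index (label k) path_vertices = k.-1.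
  have := ltn_ord k; rewrite /label {2}size_vertices; case: (nat_of_ord k) => // m lt _ /=.
  by rewrite -mem_path_vertices mem_nth // index_uniq // uniq_path_vertices.
move=> i j ij eij k /andP [ik kj].
case: (posnP i) => [i0|ipos].
  left; rewrite [label i](_ : _ = apex) ?edge_apex; last by rewrite /label i0.
  by have [] := label_pos k (leq_ltn_trans (leq0n i) ik).
have [ni ii] := label_pos i ipos.
have [nj ij'] := label_pos j (leq_ltn_trans (leq0n _) ij).
have := edge_index ni nj eij; rewrite ii ij'; lia.
Qed.

(** Natural-number coordinates on the paths, avoiding casts between dependent types; the value 0 at
    the apex is a default. *)
Definition branch a : nat := if a is inr w then tag w else 0.
Definition height a : nat := if a is inr w then tagged w else 0.

Lemma branch_height_inj a b : a != apex -> b != apex ->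
  branch a = branch b -> height a = height b -> a = b.
Proof.
case: a => [i|[i j]]; first by rewrite apexE eqxx.
case: b => [i'|[i' k]]; first by rewrite apexE eqxx.
move=> _ _ /= /val_inj E; case: _ / E k => k /val_inj <- //.
Qed.

Lemma edge_branch a b : a != apex -> b != apex -> edge a b -> branch a = branch b.
Proof.
case: a => [i|[i j]]; first by rewrite apexE eqxx.
case: b => [i'|[i' k]]; first by rewrite apexE eqxx.
by move=> _ _ /(@edge_path_vertexP i i' j k) [E _]; rewrite /= E.
Qed.

Lemma cone_longest_induced_path : 2 <= q -> (forall k, k < q -> 3 <= t k) ->
    (forall k l, k <= l -> l < q -> t k <= t l) ->
  longest_induced_path G = t q.-1 - 1.
Proof.
move=> q2 t3 tmono; have q1 : q.-1 < q by lia.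
have t3' := t3 _ q1.
apply/eqP; rewrite eqn_leq; apply/andP; split.
  apply/bigmax_leqP => k /existsP [g /andP [/injectiveP ginj /forallP gedge]].
  have {}gedge u w : edge (g u) (g w) = edge u w.
    by move/(_ u)/forallP/(_ w)/eqP: gedge.
  (* Short paths, the only ones that may pass through the apex, are covered by the lengths being at
     least 3. *)
  case: (leqP k 2) => [k2|k3]; first lia.
  have notapex u : g u != apex.
    (* A position at distance at least 2 from [u]: the start if [u] is at least 2, position 3
       otherwise. The apex would be adjacent to its image, so the copy would not be induced. *)
    apply/eqP => gu; pose w : 'I_k.+1 := if 2 <= u then ord0 else inord 3.
    have wE : nat_of_ord w = if 2 <= u then 0 else 3.
      by rewrite /w; case: ifP => // _; rewrite inordK.
    have wu : w != u by rewrite -val_eqE /= wE; move: (nat_of_ord u) => m; case: ifP; lia.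
    have := gedge u w; rewrite gu edge_apex -gu (inj_eq ginj) wu /= wE.
    by move: (nat_of_ord u) => m; case: ifP; lia.
  have same_branch u : branch (g u) = branch (g ord0).
    case: u => m; elim: m => [|m IH] lt; first by congr (branch (g _)); exact: val_inj.
    rewrite -(IH (ltnW lt)); apply: edge_branch => //.
    by rewrite gedge /= eqxx orbT.
  have below u : height (g u) < t q.-1.
    have := notapex u; case: (g u) => [i|[i j] _ /=]; first by rewrite apexE eqxx.
    by apply: leq_trans (ltn_ord j) _; apply: tmono => //; have := ltn_ord i; lia.
  have : #|'I_k.+1| <= #|'I_(t q.-1)|.
    apply: (leq_card (fun u => Ordinal (below u))) => u w [] hE; apply: ginj.
    by apply: branch_height_inj; rewrite ?same_branch.
  by rewrite !card_ord; lia.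
pose i0 : 'I_q := Ordinal q1.
have tE : (t q.-1 - 1).+1 = t i0 by rewrite /=; lia.
have ltG : t q.-1 - 1 < #|G|.
  rewrite tE -[t i0]card_ord -(card_codom (@path_vertex_inj i0)); exact: max_card.
apply: (leq_bigmax_cond (Ordinal ltG)) => /=.
apply/existsP; exists [ffun j => path_vertex (cast_ord tE j)]; apply/andP; split.
  apply/injectiveP => j k; rewrite !ffunE => /path_vertex_inj /(congr1 val) /= E.
  exact: val_inj.
by apply/forallP => j; apply/forallP => k; rewrite !ffunE edge_path_vertex.
Qed.


End ConeGraph.

(** * Edges collected along a list of vertices *)

Section ConeForest.
Variables (K : fieldType) (N : nat) (V : eqType) (xi yi : V -> 'I_N) (adj : rel V).
Local Notation forest := (@forest_binomials K N V xi yi adj).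
Local Notation f := (@edge_binomial K N V xi yi).

Lemma forest_cons b a U : forest [:: b, a & U] =
  if adj a b then f a b :: forest (a :: U) else forest (a :: U).
Proof. by []. Qed.

Lemma size_forest_cat U U' : (forall a b, a \in U -> b \in U' -> ~~ adj b a) ->
  size (forest (U ++ U')) = (size (forest U) + size (forest U'))%N.
Proof.
elim: U => [|b [|a U] IH] nadj; first by [].
  case: U' nadj {IH} => [|a U'] // nadj; rewrite cat1s forest_cons.
  by rewrite (negbTE (nadj b a _ _)) ?mem_head.
rewrite 2!cat_cons !forest_cons -cat_cons.
have {}IH := IH (fun c d cU => nadj c d (mem_behead (s := b :: a :: U) cU)).
case: ifP => _; last exact: IH.
exact: (congr1 S IH).
Qed.

Lemma size_forest_sorted U : sorted (fun b a => adj a b) U ->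
  size (forest U) = (size U).-1.
Proof.
elim: U => [|b [|a U] IH] // /andP [ab /IH E].
by rewrite forest_cons ab /= -/(forest (a :: U)) E.
Qed.

Lemma forest_nth x0 U k : (k.+1 < size U)%N -> adj (nth x0 U k.+1) (nth x0 U k) ->
  f (nth x0 U k.+1) (nth x0 U k) \in forest U.
Proof.
elim: U k => [|b [|a U] IH] k //; rewrite forest_cons; case: k => [|k] /=.
  by move=> _ ->; rewrite mem_head.
move=> lt /(IH k lt); rewrite -/(forest (a :: U)).
by case: ifP => // _ h; rewrite inE h orbT.
Qed.

Lemma mem_forest U g : g \in forest U -> exists a b,
  [/\ a \in U, b \in U, adj a b & g = f a b].
Proof.
elim: U => [|b [|a U] IH] //; rewrite forest_cons => gU.
have : (adj a b /\ g = f a b) \/ g \in forest (a :: U).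
  move: gU; case: ifP => [ab|_]; last by right.
  by rewrite inE => /predU1P [->|]; [left | right].
case=> [[ab ->]|/IH [c [d [cU dU cd ->]]]].
  by exists a, b; rewrite !inE !eqxx orbT.
by exists c, d; rewrite !(in_cons b) cU dU !orbT.
Qed.
End ConeForest.

(** Used to orient each edge binomial according to the vertex order, absorbing the sign into the
    coefficient. *)
Lemma sum_term_choice (R : pzRingType) (B B' : R -> Prop) k (c g : 'I_k -> R) :
    (forall i, B (g i)) ->
    (forall h, B h -> exists (d : R) h', B' h' /\ h = d * h') ->
  exists c' g' : 'I_k -> R, (forall i, B' (g' i)) /\
    \sum_(i < k) c i * g i = \sum_(i < k) c' i * g' i.
Proof.
move=> Bg BB'; have /fin_all_exists [d /fin_all_exists [g' P]] : forall i, exists d h', B' h' /\ g i = d * h'.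
  by move=> i; exact: BB'.
exists (fun i => c i * d i), g'; split=> [i|]; first by have [] := P i.
by apply: eq_bigr => i _; have [_ ->] := P i; rewrite mulrA.
Qed.

(** * The binomial edge ideal of the cone graph *)

Section ConeRegularity.
Variables (K : fieldType) (q : nat) (t : nat -> nat).
Local Notation G := (cone_over_paths q t).
Local Notation n := #|G|.
Implicit Types (a b : G) (i : 'I_q).

Definition x_index a : 'I_(n + n) := lshift n (enum_rank a).
Definition y_index a : 'I_(n + n) := rshift n (enum_rank a).

Lemma x_index_inj : injective x_index.
Proof. by move=> a b /lshift_inj/enum_rank_inj. Qed.

Lemma y_index_inj : injective y_index.
Proof. by move=> a b /rshift_inj/enum_rank_inj. Qed.

Lemma x_y_index a b : x_index a != y_index b.
Proof. by rewrite eq_lrshift. Qed.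

Local Notation f := (@edge_binomial K _ _ x_index y_index).
Local Notation W := (path_vertices q t).
Local Notation forest := (@forest_binomials K _ _ x_index y_index (@edge G)).
Local Notation cone := (@cone_binomials K _ _ x_index y_index (@edge G) (apex q t) W).

Lemma size_cone_forest : size (forest W) = (\sum_(i < q) (t i).-1)%N.
Proof.
have -> : (\sum_(i < q) (t i).-1 = \sum_(i <- enum 'I_q) (t i).-1)%N by rewrite big_enum.
rewrite /path_vertices; elim: (enum 'I_q) (enum_uniq 'I_q) => [|i s IH].
  by rewrite big_nil.
rewrite cons_uniq => /andP [is_ us]; rewrite big_cons [flatten _]/= size_forest_cat => [|a b].
  rewrite IH //; congr (_ + _)%N.
  suff st : sorted (fun b a => edge a b) (component t i).
    by rewrite size_forest_sorted // size_map size_enum_ord.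
  rewrite sorted_map.
  have : sorted (relpre (val : 'I_(t i) -> nat) (fun j k => k == j.+1)) (enum 'I_(t i)).
    rewrite -sorted_map val_enum_ord.
    by case: (t i) => // m /=; elim: m 0%N => //= m IHm k; rewrite eqxx IHm.
  apply: sub_sorted => j k /eqP /= E.
  suff : edge (path_vertex k) (path_vertex j) by [].
  by rewrite edge_path_vertex E eqxx orbT.
move=> /componentP [j ->] /flatten_mapP [i' i's /componentP [k ->]].
by apply/negP => /edge_path_vertexP [E _]; rewrite -E i's in is_.
Qed.

Lemma cone_ideal_edge a b : edge a b -> ideal_of cone (f a b).
Proof.
case: (eqVneq a (apex q t)) => [->|na].
  rewrite edge_apex edge_binomial_sym => nb; apply/ideal_ofN/mem_ideal_of.
  by rewrite mem_cat (map_f (fun c : G => f c (apex q t))) // mem_path_vertices.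
case: (eqVneq b (apex q t)) => [->|nb] eab.
  by apply/mem_ideal_of; rewrite mem_cat (map_f (fun c : G => f c (apex q t))) // mem_path_vertices.
have aW : a \in W by rewrite mem_path_vertices.
have bW : b \in W by rewrite mem_path_vertices.
have sub g : g \in forest W -> ideal_of cone g.
  by move=> gW; apply/mem_ideal_of; rewrite mem_cat gW orbT.
case: (edge_index na nb eab) => E.
  rewrite -(nth_index (apex q t) aW) -(nth_index (apex q t) bW) E.
  apply: sub; apply: forest_nth; first by rewrite -E index_mem.
  by rewrite -E !nth_index.
rewrite edge_binomial_sym; apply: ideal_ofN.
rewrite -(nth_index (apex q t) aW) -(nth_index (apex q t) bW) E.
apply: sub; apply: forest_nth; first by rewrite -E index_mem.
by rewrite -E !nth_index // edge_sym.
Qed.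

Lemma mem_cone g : g \in cone -> exists a b, edge a b /\ g = f a b.
Proof.
rewrite mem_cat => /orP [/mapP [a aW ->]|/mem_forest [a [b [_ _ eab ->]]]].
  exists a, (apex q t); split=> //.
  by rewrite edge_sym edge_apex -mem_path_vertices.
by exists a, b.
Qed.

(** Totality orients every edge one way or the other, and reversing an edge only changes the sign of
    its generator; hence the ideal does not depend on the order. *)
Lemma binomial_edge_ideal_cone (le : rel G) : total_order le ->
  forall p, binomial_edge_ideal K le p <-> ideal_of cone p.
Proof.
move=> [_ _ _ tot] p; split=> [[k [c [g [Bg ->]]]]|[k [c [g [gs ->]]]]].
  apply: big_ind => [|u w|i _]; [exact: ideal_of0 | exact: ideal_ofD |].
  by apply: ideal_ofM; have [a [b [_ _ eab ->]]] := Bg i; exact: cone_ideal_edge.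
have signed g0 : g0 \in cone -> exists (d : edge_ring K G) h,
    (exists a b, [/\ a != b, le a b, edge a b & h = f a b]) /\ g0 = d * h.
  move=> /mem_cone [a [b [eab ->]]].
  have ab : a != b by apply: contraTneq eab => ->; rewrite edge_irr.
  case/orP: (tot a b) => lab.
    by exists 1, (f a b); rewrite mul1r; split=> //; exists a, b.
  exists (-1), (f b a); rewrite mulN1r -edge_binomial_sym; split=> //.
  by exists b, a; rewrite eq_sym edge_sym.
have [c' [g' [Bg' ->]]] := sum_term_choice c gs signed.
by exists k, c', g'.
Qed.

Lemma reg_cone_over_paths (le : rel G) : total_order le ->
    (1 < \sum_(i < q) (t i).-1)%N ->
  reg (binomial_edge_ideal K le) = (\sum_(i < q) (t i).-1).+1%:Z.
Proof.
move=> tot; rewrite -size_cone_forest => gt1.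
apply: (reg_cone x_index_inj y_index_inj x_y_index (uniq_vertices q t) gt1).
exact: binomial_edge_ideal_cone.
Qed.

End ConeRegularity.

End ConeRegularity.

From mathcomp Require Import all_classical all_reals all_analysis.
Import ConeRegularity.
Import Order.TTheory GRing.Theory Num.Theory numFieldNormedType.Exports.
Local Open Scope classical_set_scope.
Local Open Scope ring_scope.

Theorem mainTheorem6 (K : fieldType) (R : realType) :
  (forall (q : nat) (t : nat -> nat),
     (2 <= q)%N ->
     (forall i, (i < q)%N -> (3 <= t i)%N) ->
     (forall i j, (i <= j)%N -> (j < q)%N -> (t i <= t j)%N) ->
     let G := cone_over_paths q t in
     [/\ connected_graph G,
         weakly_closed G,
         longest_induced_path G = (t q.-1 - 1)%N &
         forall le : rel G, total_order le ->
           reg (binomial_edge_ideal K le) =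
             (\sum_(i < q) (t i)%:Z) - q%:Z + 1 /\
           reg (binomial_edge_ideal K le) <> (longest_induced_path G)%:Z + 1])
  /\
  (let G_ (q : nat) := cone_over_paths q (fun=> (q ^ 2)%N) in
   forall le : forall q, rel (G_ q),
     (forall q, (2 <= q)%N -> total_order (le q)) ->
     (fun q : nat => (reg (binomial_edge_ideal K (le q)))%:~R /
                     (longest_induced_path (G_ q) + 1)%:R : R)
       @ \oo --> +oo).
Proof.
(* Each path has one edge fewer than vertices; the additive form avoids truncated subtraction. *)
have sum_pred q (t : nat -> nat) : (forall i, (i < q)%N -> (3 <= t i)%N) ->
    (\sum_(i < q) t i = \sum_(i < q) (t i).-1 + q)%N.
  move=> t3; rewrite -[X in (_ + X)%N](card_ord q) -sum1_card -big_split /=.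
  by apply: eq_bigr => i _; rewrite addn1 prednK //; apply: leq_trans (t3 i (ltn_ord i)).
have invariants q t : (2 <= q)%N -> (forall i, (i < q)%N -> (3 <= t i)%N) ->
    (forall i j, (i <= j)%N -> (j < q)%N -> (t i <= t j)%N) ->
    longest_induced_path (cone_over_paths q t) = (t q.-1 - 1)%N /\
    forall le : rel (cone_over_paths q t), total_order le ->
      reg (binomial_edge_ideal K le) = (\sum_(i < q) (t i).-1).+1%:Z /\
      (t q.-1 - 1 < \sum_(i < q) (t i).-1)%N.
  move=> q2 t3 tmono; split; first exact: cone_longest_induced_path.
  (* The first path has at least 2 edges and the last, a different one as q is at least 2, has one
     edge fewer than vertices; together they already exceed [t q.-1]. *)
  have lt : (t q.-1 < \sum_(i < q) (t i).-1)%N.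
    case: q q2 t3 {tmono} => [|[|q]] // _ t3 /=.
    rewrite big_ord_recr big_ord_recl /=.
    by have := t3 0%N isT; have := t3 q.+1 (ltnSn _); lia.
  move=> le tot; split; last by apply: leq_ltn_trans lt; exact: leq_subr.
  apply: reg_cone_over_paths => //; apply: leq_ltn_trans lt.
  by apply: leq_trans (t3 q.-1 _); lia.
split=> [q t q2 t3 tmono G|G_ le tot].
  have [lip regE] := invariants q t q2 t3 tmono; split=> //.
  - exact: cone_connected.
  - exact: cone_weakly_closed.
  move=> le tot; have [-> lt] := regE le tot; rewrite lip.
  have t3' : (3 <= t q.-1)%N by apply: t3; lia.
  split; last by lia.
  have -> : \sum_(i < q) (t i)%:Z = (\sum_(i < q) t i)%:Z.
    by rewrite (big_morph Posz PoszD (erefl _)).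
  by rewrite (sum_pred q t t3); lia.
apply/cvgryPge => A; near=> q.
have q2 : (2 <= q)%N by near: q; exact: nbhs_infty_ge.
have sq3 : (3 <= q ^ 2)%N by rewrite expnS expn1; nia.
have [-> regE] := invariants q (fun=> (q ^ 2)%N) q2 (fun _ _ => sq3) (fun _ _ _ _ => leqnn _).
have [-> _] := regE (le q) (tot q q2).
rewrite sum_nat_const card_ord subnK; last by apply: leq_trans sq3.
have sq0 : (0 : R) < (q ^ 2)%:R by rewrite ltr0n; lia.
rewrite ler_pdivlMr // -pmulrn.
(* The ratio is (q (q^2 - 1) + 1) / q^2, which is at least q - 1. *)
apply: (@le_trans _ _ ((q.-1)%:R * (q ^ 2)%:R)).
  rewrite ler_pM2r //.
  rewrite -subn1 natrB; last by lia.
  by rewrite lerBrDr; near: q; exact: nbhs_infty_ger.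
rewrite -natrM ler_nat; nia.
Unshelve. all: by end_near. Qed.
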